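(* Let $N\ge 1$. The category of compact Hausdorff spaces with a fixed covering by $N$ closed subsets is (contravariantly) equivalent to the category of flabby sheaves of commutative unital $C^*$-algebras over the space $\mathbb{P}^{N-1}(\mathbb{Z}/2)$.
   Context: The space $\mathbb{P}^{N-1}(\mathbb{Z}/2)$ is the set $\{0,1\}^N\setminus\{(0,\ldots,0)\}$ with the topology generated by (i.e. having as a subbasis) the subsets $A_i:=\{(z_1,\ldots,z_N)\mid z_i\neq 0\}$, $i=1,\ldots,N$. An object of the first category is a compact Hausdorff space $X$ together with an $N$-tuple $(X_1,\ldots,X_N)$ of closed subsets (possibly empty) with $X=X_1\cup\cdots\cup X_N$; a morphism $(X;X_1,\ldots,X_N)\to(Y;Y_1,\ldots,Y_N)$ is a continuous map $f:X\to Y$ with $f(X_i)\subseteq Y_i$ for all $i$. A sheaf $\mathcal{P}$ is flabby if for all open $V\subseteq U$ the restriction map $\mathcal{P}(U)\to\mathcal{P}(V)$ is surjective. In a sheaf of commutative unital $C^*$-algebras the restriction maps are unital $*$-homomorphisms; morphisms of such sheaves are morphisms of sheaves whose components are unital $*$-homomorphisms. The zero algebra is allowed as a unital $C^*$-algebra (there is no unital morphism from the zero algebra to a nonzero one). *)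

(* Defs.v *)
From HB Require Import structures.
From mathcomp Require Import all_boot all_order all_algebra.
From mathcomp Require Import complex.
From mathcomp Require Import boolp classical_sets reals topology normedtype.

Set Implicit Arguments.
Unset Strict Implicit.
Unset Printing Implicit Defensive.

Import Order.TTheory GRing.Theory Num.Theory.
Import numFieldNormedType.Exports.

Local Open Scope classical_set_scope.
Local Open Scope ring_scope.

Record category := Category {
  obj :> Type;
  hom : obj -> obj -> Type;
  idm : forall a, hom a a;
  comp : forall a b c, hom b c -> hom a b -> hom a c;
  comp1m : forall a b (f : hom a b), comp (idm b) f = f;
  compm1 : forall a b (f : hom a b), comp f (idm a) = f;
  compA : forall a b c d (f : hom c d) (g : hom b c) (h : hom a b),
    comp f (comp g h) = comp (comp f g) h }.

Arguments hom {c0} a b.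
Arguments idm {c0} a.
Arguments comp {c0 a b c} f g.

Definition opposite (C : category) : category :=
  @Category C (fun a b => hom b a) idm (fun a b c f g => comp g f)
    (fun a b f => compm1 f) (fun a b f => comp1m f)
    (fun a b c d f g h => esym (compA h g f)).

Record functor (C D : category) := Functor {
  fobj :> C -> D;
  fmap : forall a b : C, hom a b -> hom (fobj a) (fobj b);
  fmap1 : forall a : C, fmap (idm a) = idm (fobj a);
  fmapM : forall (a b c : C) (f : hom b c) (g : hom a b),
    fmap (comp f g) = comp (fmap f) (fmap g) }.

Arguments fmap {C D} f0 {a b} f.

Definition functor_id (C : category) : functor C C :=
  @Functor C C id (fun a b f => f) (fun a => erefl) (fun a b c f g => erefl).

Lemma functor_comp1 (C D E : category) (G : functor D E) (F : functor C D)
  (a : C) : fmap G (fmap F (idm a)) = idm (G (F a)).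
Proof. by rewrite !fmap1. Qed.

Lemma functor_compM (C D E : category) (G : functor D E) (F : functor C D)
  (a b c : C) (f : hom b c) (g : hom a b) :
  fmap G (fmap F (comp f g)) =
  comp (fmap G (fmap F f)) (fmap G (fmap F g)).
Proof. by rewrite !fmapM. Qed.

Definition functor_comp (C D E : category) (G : functor D E) (F : functor C D)
    : functor C E :=
  @Functor C E (fun a => G (F a)) (fun a b f => fmap G (fmap F f))
    (functor_comp1 G F) (functor_compM G F).

Definition isomorphism (C : category) (a b : C) (f : hom a b) : Prop :=
  exists g : hom b a, comp g f = idm a /\ comp f g = idm b.

Definition naturally_isomorphic (C D : category) (F G : functor C D) : Prop :=
  exists eta : forall a : C, hom (F a) (G a),
    (forall (a b : C) (f : hom a b),
       comp (fmap G f) (eta a) = comp (eta b) (fmap F f)) /\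
    (forall a : C, isomorphism (eta a)).

Definition equivalent (C D : category) : Prop :=
  exists (F : functor C D) (G : functor D C),
    naturally_isomorphic (functor_comp G F) (functor_id C) /\
    naturally_isomorphic (functor_comp F G) (functor_id D).

Definition contravariantly_equivalent (C D : category) : Prop :=
  equivalent (opposite C) D.

Record covered_space (N : nat) := CoveredSpace {
  cspace :> topologicalType;
  piece : 'I_N -> set cspace;
  cspace_compact : compact [set: cspace];
  cspace_hausdorff : hausdorff_space cspace;
  piece_closed : forall i, closed (piece i);
  piece_cover : \bigcup_i piece i = [set: cspace] }.

Arguments piece {N} c i.

Record covered_map (N : nat) (X Y : covered_space N) := CoveredMap {
  cmap :> X -> Y;
  cmap_continuous : continuous cmap;
  cmap_piece : forall i, cmap @` piece X i `<=` piece Y i }.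

Section CoveredSpaceCategory.
Variable N : nat.
Implicit Types X Y Z W : covered_space N.

Lemma covered_map_eq X Y (f g : covered_map X Y) : f =1 g -> f = g.
Proof.
case: f g => [f cf pf] [g cg pg] /= /funext fg; subst g.
by congr CoveredMap; exact: Prop_irrelevance.
Qed.

Lemma covered_id_piece X i : id @` piece X i `<=` piece X i.
Proof. by rewrite image_id. Qed.

Definition covered_id X : covered_map X X :=
  @CoveredMap N X X id (fun x => @cvg_id X (nbhs x)) (@covered_id_piece X).

Lemma covered_comp_continuous X Y Z (f : covered_map Y Z)
  (g : covered_map X Y) : continuous (f \o g).
Proof.
by move=> x; apply: continuous_comp; exact: cmap_continuous.
Qed.

Lemma covered_comp_piece X Y Z (f : covered_map Y Z) (g : covered_map X Y) i :
  (f \o g) @` piece X i `<=` piece Z i.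
Proof.
move=> _ [x Xx <-]; apply: (@cmap_piece _ _ _ f); exists (g x) => //.
by apply: (@cmap_piece _ _ _ g); exists x.
Qed.

Definition covered_comp X Y Z (f : covered_map Y Z) (g : covered_map X Y)
    : covered_map X Z :=
  CoveredMap (@covered_comp_continuous X Y Z f g)
             (@covered_comp_piece X Y Z f g).

Lemma covered_comp1m X Y (f : covered_map X Y) :
  covered_comp (covered_id Y) f = f.
Proof. exact: covered_map_eq. Qed.

Lemma covered_compm1 X Y (f : covered_map X Y) :
  covered_comp f (covered_id X) = f.
Proof. exact: covered_map_eq. Qed.

Lemma covered_compA X Y Z W (f : covered_map Z W) (g : covered_map Y Z)
  (h : covered_map X Y) :
  covered_comp f (covered_comp g h) = covered_comp (covered_comp f g) h.
Proof. exact: covered_map_eq. Qed.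

Definition covered_spaces : category :=
  Category covered_comp1m covered_compm1 covered_compA.

End CoveredSpaceCategory.

(* Commutative unital C*-algebras over the complex numbers R[i]. The ring
   structure is spelled out because MathComp's [comAlgType] excludes the zero
   algebra, which is allowed here (cone = 0 is not ruled out), and because
   Hierarchy-Builder rejects a join of [completeNormedModType] with
   [comPzRingType]. *)
HB.mixin Record isCommCStarAlgebra (R : realType) A
    & CompleteNormedModule R[i] A := {
  cone : A;
  cmul : A -> A -> A;
  star : A -> A;
  cmulA : associative cmul;
  cmulC : commutative cmul;
  cmul1a : left_id cone cmul;
  cmulDl : left_distributive cmul +%R;
  cmulZl : forall (c : R[i]) (a b : A), cmul (c *: a) b = c *: cmul a b;
  starK : involutive star;
  starD : {morph star : a b / a + b};
  starZ : forall (c : R[i]) (a : A), star (c *: a) = (c^*)%C *: star a;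
  starM : forall a b : A, star (cmul a b) = cmul (star b) (star a);
  cnormM : forall a b : A, `|cmul a b| <= `|a| * `|b|;
  cnorm_star : forall a : A, `|cmul (star a) a| = `|a| ^+ 2 }.

#[short(type="commCStarType")]
HB.structure Definition CommCStarAlgebra (R : realType) :=
  { A of CompleteNormedModule R[i] A & isCommCStarAlgebra R A }.

Arguments cone {R s}.

(* No continuity is required: a *-homomorphism is automatically contractive. *)
Record star_hom (R : realType) (A B : commCStarType R) := StarHom {
  star_fun :> A -> B;
  star_fun_linear : linear star_fun;
  star_fun1 : star_fun cone = cone;
  star_funM : {morph star_fun : a b / cmul a b};
  star_fun_star : {morph star_fun : a / star a} }.

Section StarHom.
Variable R : realType.
Implicit Types A B C : commCStarType R.

Lemma star_hom_eq A B (f g : star_hom A B) : f =1 g -> f = g.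
Proof.
case: f g => [f ? ? ? ?] [g ? ? ? ?] /= /funext fg; subst g.
by congr StarHom; exact: Prop_irrelevance.
Qed.

Definition star_id A : star_hom A A :=
  @StarHom R A A id (fun _ _ _ => erefl) erefl (fun _ _ => erefl)
    (fun=> erefl).

Section Comp.
Variables (A B C : commCStarType R) (f : star_hom B C) (g : star_hom A B).

Lemma star_comp_linear : linear (f \o g).
Proof. by move=> c a b /=; rewrite !star_fun_linear. Qed.

Lemma star_comp1 : (f \o g) cone = cone.
Proof. by rewrite /= !star_fun1. Qed.

Lemma star_compM : {morph f \o g : a b / cmul a b}.
Proof. by move=> a b /=; rewrite !star_funM. Qed.

Lemma star_comp_star : {morph f \o g : a / star a}.
Proof. by move=> a /=; rewrite !star_fun_star. Qed.

Definition star_comp : star_hom A C :=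
  StarHom star_comp_linear star_comp1 star_compM star_comp_star.

End Comp.
End StarHom.

Record opens (T : topologicalType) := Opens {
  oset :> set T;
  osetP : open oset }.

Definition opensI (T : topologicalType) (U V : opens T) : opens T :=
  Opens (openI (osetP U) (osetP V)).

Record sheaf (R : realType) (T : topologicalType) := Sheaf {
  sect :> opens T -> commCStarType R;
  res : forall U V : opens T, V `<=` U -> star_hom (sect U) (sect V);
  res_id : forall (U : opens T) (UU : U `<=` U) (s : sect U), res UU s = s;
  res_comp : forall (U V W : opens T) (VU : V `<=` U) (WV : W `<=` V)
    (WU : W `<=` U) (s : sect U), res WV (res VU s) = res WU s;
  sheaf_locality : forall (U : opens T) (I : Type) (V : I -> opens T)
    (VU : forall i, V i `<=` U), \bigcup_i V i = U ->
    forall s t : sect U, (forall i, res (VU i) s = res (VU i) t) -> s = t;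
  sheaf_gluing : forall (U : opens T) (I : Type) (V : I -> opens T)
    (VU : forall i, V i `<=` U), \bigcup_i V i = U ->
    forall s : forall i, sect (V i),
    (forall i j,
       res (V := opensI (V i) (V j)) (@subIsetl _ (V i) (V j)) (s i) =
       res (V := opensI (V i) (V j)) (@subIsetr _ (V i) (V j)) (s j)) ->
    exists t : sect U, forall i, res (VU i) t = s i }.

Arguments res {R T} s0 {U V} _.

Definition flabby (R : realType) (T : topologicalType) (P : sheaf R T) : Prop :=
  forall (U V : opens T) (VU : V `<=` U) (t : P V),
    exists s : P U, res P VU s = t.

Record sheaf_hom (R : realType) (T : topologicalType) (P Q : sheaf R T) :=
  SheafHom {
    sheaf_fun :> forall U : opens T, star_hom (P U) (Q U);
    sheaf_fun_res : forall (U V : opens T) (VU : V `<=` U) (s : P U),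
      sheaf_fun V (res P VU s) = res Q VU (sheaf_fun U s) }.

Record flabby_sheaf (R : realType) (T : topologicalType) := FlabbySheaf {
  fsheaf :> sheaf R T;
  fsheafP : flabby fsheaf }.

Section FlabbySheafCategory.
Variables (R : realType) (T : topologicalType).
Implicit Types P Q S : sheaf R T.

Lemma sheaf_hom_eq P Q (f g : sheaf_hom P Q) :
  (forall U, f U =1 g U) -> f = g.
Proof.
case: f g => [f rf] [g rg] /= fg.
have {}fg : f = g by apply: functional_extensionality_dep => U; exact: star_hom_eq.
by subst g; congr SheafHom; exact: Prop_irrelevance.
Qed.

Definition sheaf_id P : sheaf_hom P P :=
  @SheafHom R T P P (fun U => star_id (P U)) (fun _ _ _ _ => erefl).

Lemma sheaf_comp_res P Q S (f : sheaf_hom Q S) (g : sheaf_hom P Q)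
  (U V : opens T) (VU : V `<=` U) (s : P U) :
  star_comp (f V) (g V) (res P VU s) = res S VU (star_comp (f U) (g U) s).
Proof. by rewrite /= !sheaf_fun_res. Qed.

Definition sheaf_comp P Q S (f : sheaf_hom Q S) (g : sheaf_hom P Q)
    : sheaf_hom P S :=
  @SheafHom R T P S (fun U => star_comp (f U) (g U)) (sheaf_comp_res f g).

Lemma sheaf_comp1m P Q (f : sheaf_hom P Q) : sheaf_comp (sheaf_id Q) f = f.
Proof. exact: sheaf_hom_eq. Qed.

Lemma sheaf_compm1 P Q (f : sheaf_hom P Q) : sheaf_comp f (sheaf_id P) = f.
Proof. exact: sheaf_hom_eq. Qed.

Lemma sheaf_compA P Q S W (f : sheaf_hom S W) (g : sheaf_hom Q S)
  (h : sheaf_hom P Q) :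
  sheaf_comp f (sheaf_comp g h) = sheaf_comp (sheaf_comp f g) h.
Proof. exact: sheaf_hom_eq. Qed.

Definition flabby_sheaves : category :=
  @Category (flabby_sheaf R T) (fun F G => sheaf_hom F G)
    (fun F => sheaf_id F) (fun F G H => @sheaf_comp F G H)
    (fun F G => @sheaf_comp1m F G) (fun F G => @sheaf_compm1 F G)
    (fun F G H K => @sheaf_compA F G H K).

End FlabbySheafCategory.

(* [projective_space N] is P^(N-1)(Z/2). *)
Definition projective_space (N : nat) : Type := {z : 'rV['F_2]_N | z != 0}.

HB.instance Definition _ (N : nat) := Choice.on (projective_space N).

Definition chart (N : nat) (i : 'I_N) : set (projective_space N) :=
  [set z : projective_space N | (sval z : 'rV['F_2]_N) ord0 i != 0].

HB.instance Definition _ (N : nat) :=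
  isSubBaseTopological.Build (projective_space N) (range (@chart N)) id.

(* Main.v *)
(** Gelfand duality identifies compact Hausdorff spaces with commutative unital
    C*-algebras.  For a covered space X and a point x let sigma(x) be the point
    of P^(N-1)(Z/2) whose support is {i | x in X_i}.  An open set U is an upward
    closed set of supports, so X_U := sigma^-1(U) is a closed subset of X, and
    U |-> C(X_U) is a sheaf which is flabby by Tietze's theorem.  Conversely, a
    flabby sheaf P yields the spectrum X of its global sections, covered by the
    closed sets X_i of the characters that factor through P(A_i), where A_i is
    the i-th chart.  Writing J_U for the kernel of restriction to U, locality
    gives J_(U u V) = J_U n J_V, and gluing plus flabbiness give
    J_(U n V) = J_U + J_V; hence X_U is the set of characters that factor
    through P(U), and P(U) = C(X_U).

    Gelfand's theorem itself is obtained without complex analysis.  Square roots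
    exist by a contraction argument and define a cone of positive elements; a
    maximal preordering containing it determines a character by a Dedekind cut,
    which yields that the Gelfand transform is isometric, and Stone-Weierstrass
    that it is onto. *)

From HB Require Import structures.
From mathcomp Require Import all_boot all_order all_algebra.
From mathcomp Require Import complex ring lra.
From mathcomp Require Import boolp classical_sets functions cardinality.
From mathcomp Require Import reals topology normedtype sequences.
From mathcomp Require Import derive numfun.
Require Import Defs.

Set Implicit Arguments.
Unset Strict Implicit.
Unset Printing Implicit Defensive.

Import Order.TTheory GRing.Theory Num.Theory.
Import numFieldNormedType.Exports.

Local Open Scope classical_set_scope.
Local Open Scope ring_scope.
Local Open Scope complex_scope.

(** * Commutative C*-algebras as rings *)

(** Flabbiness reduces everything to one algebra: restrictions from the whole space are onto, so
    each [P U] is a quotient of the global sections and its characters are points of one compact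
    space. The comparison of [P U] with the functions on X_U uses Gelfand duality twice: for [P U]
    itself to get injectivity, and for the global sections, after a Tietze extension, to get
    surjectivity. No quotient norm enters.

    Finiteness of the projective space matters on both sides: an open set is a finite union of
    smallest neighbourhoods [star_nbhs z], so X_U is a finite union of closed sets, continuous
    functions can be pasted along it, and the rules for binary unions and intersections reach every
    open set.

    Without spectral theory, positivity is a norm condition ([Pos]). Sums are then immediate, while
    squares and products have to be extracted from the C*-identity. The contraction behind square
    roots needs norm strictly below 1, whence the recurrent additive [e]. *)

(* Carries the ring structure, kept apart from the normed structure of [A]. *)
Definition cstar_ring (R : realType) (A : commCStarType R) : Type := A.

Section CStarRing.
Variables (R : realType) (A : commCStarType R).
Local Notation B := (cstar_ring A).

HB.instance Definition _ := GRing.Zmodule.copy B A.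
HB.instance Definition _ := GRing.Zmodule_isComPzRing.Build B
  (@cmulA R A) (@cmulC R A) (@cmul1a R A) (@cmulDl R A).

Definition scalar_of (c : R[i]) : B := c *: (cone : A).

Lemma scalar_ofB : zmod_morphism scalar_of.
Proof. by move=> c d; rewrite /scalar_of scalerBl. Qed.

Lemma scalar_ofM : monoid_morphism scalar_of.
Proof.
split; first by rewrite /scalar_of scale1r.
by move=> c d; rewrite /scalar_of -[RHS]/(cmul _ _) cmulZl cmul1a scalerA.
Qed.

HB.instance Definition _ := GRing.isZmodMorphism.Build R[i] B scalar_of scalar_ofB.
HB.instance Definition _ := GRing.isMonoidMorphism.Build R[i] B scalar_of scalar_ofM.

Definition real_of (r : R) : B := scalar_of r%:C.

Lemma real_ofB : zmod_morphism real_of.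
Proof. by move=> c d; rewrite /real_of !rmorphB. Qed.

Lemma real_ofM : monoid_morphism real_of.
Proof.
by split; [rewrite /real_of !rmorph1|move=> c d; rewrite /real_of !rmorphM].
Qed.

HB.instance Definition _ := GRing.isZmodMorphism.Build R B real_of real_ofB.
HB.instance Definition _ := GRing.isMonoidMorphism.Build R B real_of real_ofM.

Lemma scalar_ofE (c : R[i]) (a : A) : c *: a = scalar_of c * (a : B).
Proof. by rewrite -[RHS]/(cmul _ _) cmulZl cmul1a. Qed.

Definition adj (a : B) : B := star (a : A).

Lemma adjK : involutive adj. Proof. exact: (@starK R A). Qed.
Lemma adjM : {morph adj : a b / a * b}.
Proof. by move=> a b; rewrite [RHS]mulrC; exact: (@starM R A). Qed.
Lemma adjD : {morph adj : a b / a + b}. Proof. exact: (@starD R A). Qed.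
Lemma adj1 : adj 1 = 1.
Proof. by have := adjM 1 (adj 1); rewrite mul1r adjK mulr1. Qed.
Lemma adj_scalar c : adj (scalar_of c) = scalar_of c^*.
Proof. by rewrite /adj /scalar_of starZ -[star _]/(adj 1) adj1. Qed.
Lemma adj_real r : adj (real_of r) = real_of r.
Proof. by rewrite /real_of adj_scalar conjc_real. Qed.
Lemma adj0 : adj 0 = 0.
Proof. by rewrite -(rmorph0 real_of) adj_real. Qed.
Lemma adjN a : adj (- a) = - adj a.
Proof. by apply/eqP; rewrite -addr_eq0 -adjD addNr adj0. Qed.
Lemma adjB a b : adj (a - b) = adj a - adj b.
Proof. by rewrite adjD adjN. Qed.

(** The norm of [A] takes values in [R[i]]; this real-valued copy brings the estimates within reach
    of real arithmetic. *)
Definition nm (a : B) : R := complex.Re `|(a : A)|.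

Lemma nmE (a : A) : `|a| = (nm a)%:C.
Proof. by rewrite /nm RRe_real// ger0_real. Qed.
Lemma nm_ge0 a : 0 <= nm a.
Proof. by rewrite -lecR -nmE normr_ge0. Qed.
Lemma nm0_eq0 a : nm a = 0 -> a = 0.
Proof.
move=> h; have /normr0_eq0 : `|(a : A)| = 0 by rewrite nmE h.
by [].
Qed.
Lemma nm0 : nm 0 = 0. Proof. by rewrite /nm normr0. Qed.
Lemma nmD a b : nm (a + b) <= nm a + nm b.
Proof. by rewrite -lecR rmorphD /= -!nmE; exact: (@ler_normD _ A). Qed.
Lemma nmN a : nm (- a) = nm a.
Proof. by rewrite /nm -[X in `|X|]/(- (a : A)) normrN. Qed.
Lemma nmB a b : nm (a - b) = nm (b - a). Proof. by rewrite -nmN opprB. Qed.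
Lemma nmM a b : nm (a * b) <= nm a * nm b.
Proof. by rewrite -lecR rmorphM /= -!nmE; exact: (@cnormM R A). Qed.
Lemma nmadjM a : nm (adj a * a) = nm a ^+ 2.
Proof.
by apply: complexI; rewrite rmorphXn /= -!nmE; exact: (@cnorm_star R A).
Qed.
Lemma nm_real r a : nm (real_of r * a) = `|r| * nm a.
Proof.
apply: complexI; rewrite rmorphM /= -!nmE -scalar_ofE normrZ; congr (_ * _).
by rewrite normc_def /= expr0n /= addr0 sqrtr_sqr.
Qed.

(** The C*-identity gives [nm b ^+ 2 <= nm (adj b) * nm b]; cancel [nm b], then use the result for
    [a] and for [adj a]. *)
Lemma nm_adj a : nm (adj a) = nm a.
Proof.
have le b : nm b <= nm (adj b).
  have [->|b0] := eqVneq (nm b) 0; first exact: nm_ge0.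
  have := nmM (adj b) b; rewrite nmadjM expr2 ler_pM2r // lt_def b0.
  exact: nm_ge0.
by apply/eqP; rewrite eq_le le -{2}(adjK a) le.
Qed.

(** The C*-identity makes [nm 1] idempotent, hence 0 or 1; the value 0 is that of the zero
    algebra. *)
Lemma nm1 : nm 1 <= 1.
Proof.
have := nmadjM 1; rewrite adj1 mulr1 => h.
have := nm_ge0 1; nra.
Qed.

Lemma nm_real_le r : nm (real_of r) <= `|r|.
Proof.
have := nm_real r 1; rewrite mulr1 => ->.
by rewrite ler_piMr // nm1.
Qed.

Definition cauchy_nm (u : nat -> B) := forall e, 0 < e ->
  exists n0, forall m n, (n0 <= m)%N -> (n0 <= n)%N -> nm (u m - u n) < e.

Lemma cauchy_nm_cvg (u : nat -> B) : cauchy_nm u ->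
  exists l : B, forall e, 0 < e ->
    exists n0, forall n, (n0 <= n)%N -> nm (l - u n) < e.
Proof.
move=> cu.
have /cauchy_cvgP/cvg_ex[l lP] : cauchy ((u : nat -> A) @ \oo).
  (* Radii range over [R[i]], whose order makes every positive element real. *)
  apply/(@cauchy_ballP R[i] A) => e; rewrite ltcE /= => /andP[/eqP e0 e1].
  have {}e0 : e = (complex.Re e)%:C by case: e e0 {e1} => x y /= ->.
  have [n0 h] := cu _ e1.
  near_simpl; near=> m n; rewrite /= -ball_normE /=.
  rewrite nmE e0 ltcR; apply: h; [near: m|near: n]; exact: nbhs_infty_ge.
exists l => e e0; move/cvgrPdist_lt : lP => /(_ e%:C); rewrite ltcR.
move=> /(_ e0)[n0 _ h]; exists n0 => n n0n; have := h _ n0n.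
by rewrite /= nmE ltcR.
Unshelve. all: by end_near. Qed.

Definition SA (a : B) := adj a = a.

Lemma SA1 : SA 1. Proof. exact: adj1. Qed.
Lemma SAr r : SA (real_of r). Proof. exact: adj_real. Qed.
Lemma SAD a b : SA a -> SA b -> SA (a + b).
Proof. by rewrite /SA adjD => -> ->. Qed.
Lemma SAN a : SA a -> SA (- a). Proof. by rewrite /SA adjN => ->. Qed.
Lemma SAB a b : SA a -> SA b -> SA (a - b).
Proof. by move=> ha hb; apply: SAD => //; exact: SAN. Qed.
Lemma SAM a b : SA a -> SA b -> SA (a * b).
Proof. by rewrite /SA adjM => -> ->. Qed.
Lemma SAX a n : SA a -> SA (a ^+ n).
Proof. by move=> h; elim: n => [|n ih]; rewrite ?exprS; [exact: SA1|exact: SAM]. Qed.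
Lemma SA0 : SA 0. Proof. exact: adj0. Qed.

Lemma SA_lim (u : nat -> B) l : (forall n, SA (u n)) ->
  (forall e, 0 < e -> exists n, nm (l - u n) < e) -> SA l.
Proof.
move=> su ul; apply/eqP; rewrite -subr_eq0; apply/eqP/nm0_eq0/eqP.
rewrite eq_le nm_ge0 andbT; apply/ler_addgt0Pr => e e0; rewrite add0r.
have [n hn] := ul _ (divr_gt0 e0 (ltr0Sn R 1)).
have -> : adj l - l = adj (l - u n) - (l - u n) by rewrite adjB (su n); ring.
have := nmD (adj (l - u n)) (- (l - u n)); rewrite nmN nm_adj; lra.
Qed.

Lemma nm_sqr a : SA a -> nm (a ^+ 2) = nm a ^+ 2.
Proof. by move=> sa; rewrite -nmadjM sa expr2. Qed.

End CStarRing.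

(** * Square roots and positive elements *)

Lemma expr_small (R : realType) (q e : R) : 0 <= q < 1 -> 0 < e ->
  exists n0, forall n, (n0 <= n)%N -> q ^+ n < e.
Proof.
move=> /andP[q0 q1] e0; have /cvgrPdist_lt/(_ _ e0)[n0 _ h] : @GRing.exp R q @ \oo --> (0:R).
  by apply: cvg_expr; rewrite ger0_norm.
exists n0 => n n0n; have := h _ n0n.
by rewrite /= sub0r normrN ger0_norm // exprn_ge0.
Qed.

Section PositiveCone.
Variables (R : realType) (A : commCStarType R).
Local Notation B := (cstar_ring A).
Implicit Types (a b x y s : B) (e t r : R).

Definition sqrt_step x y : B := real_of A 2^-1 * (x + y ^+ 2).
Definition sqrt_iter x n : B := iter n (sqrt_step x) 0.

Lemma nm_half a : nm (real_of A 2^-1 * a) = 2^-1 * nm a.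
Proof. by rewrite nm_real ger0_norm// invr_ge0. Qed.

Lemma sqrt_stepB x y y' :
  nm (sqrt_step x y - sqrt_step x y') <= 2^-1 * (nm y + nm y') * nm (y - y').
Proof.
have -> : sqrt_step x y - sqrt_step x y' = real_of A 2^-1 * ((y + y') * (y - y')).
  by rewrite /sqrt_step; ring.
rewrite nm_half -mulrA ler_pM2l ?invr_gt0 //.
by apply: le_trans (nmM _ _) _; rewrite ler_wpM2r ?nm_ge0 ?nmD.
Qed.

Lemma nm_sqrt_step x y : nm x <= 1 -> nm y <= nm x -> nm (sqrt_step x y) <= nm x.
Proof.
move=> x1 yx; rewrite nm_half.
have := nmD x (y ^+ 2); have := nmM y y; rewrite -expr2.
have := nm_ge0 x; have := nm_ge0 y; nra.
Qed.

(* The self-map [y |-> (x + y^2) / 2] contracts the ball of radius [nm x], and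
   its fixed point [y] satisfies [(1 - y)^2 = 1 - x]. *)
Lemma sqrt1B x : SA x -> nm x < 1 ->
  exists s, [/\ SA s, nm (1 - s) <= 1 & s ^+ 2 = 1 - x].
Proof.
move=> sx x1; set q := nm x; have q0 : 0 <= q := nm_ge0 x.
have yq n : nm (sqrt_iter x n) <= q.
  elim: n => [|n ih] /=; first by rewrite nm0.
  by apply: nm_sqrt_step => //; exact: ltW.
have sy n : SA (sqrt_iter x n).
  elim: n => [|n ih] /=; first exact: SA0.
  by apply: SAM; [exact: SAr | apply: SAD => //; exact: SAX].
have dy n : nm (sqrt_iter x n.+1 - sqrt_iter x n) <= q ^+ n.
  elim: n => [|n ih]; first by rewrite subr0 expr0; apply: le_trans (yq 1%N) (ltW x1).
  apply: le_trans (sqrt_stepB _ _ _) _; rewrite exprS.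
  apply: ler_pM => //; rewrite ?nm_ge0 ?mulr_ge0 ?addr_ge0 ?nm_ge0 ?invr_ge0//.
  have := yq n.+1; have := yq n; lra.
have tele n k : nm (sqrt_iter x (n + k) - sqrt_iter x n) * (1 - q) <= q ^+ n - q ^+ (n + k).
  elim: k => [|k ih]; first by rewrite addn0 !subrr nm0 mul0r.
  have q1 : 0 < 1 - q by rewrite subr_gt0.
  have := nmD (sqrt_iter x (n + k).+1 - sqrt_iter x (n + k)) (sqrt_iter x (n + k) - sqrt_iter x n).
  rewrite subrKA addnS exprS => /(ler_wpM2r (ltW q1)).
  have := ler_wpM2r (ltW q1) (dy (n + k)%N).
  nra.
have [l hl] : exists l : B, forall e, 0 < e ->
    exists n0, forall n, (n0 <= n)%N -> nm (l - sqrt_iter x n) < e.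
  apply: cauchy_nm_cvg => e e0; have q1 : 0 < 1 - q by rewrite subr_gt0.
  have [||n0 h] := @expr_small _ q (e / 2 * (1 - q)).
  - by rewrite q0 x1.
  - by apply: mulr_gt0 => //; apply: divr_gt0.
  have hm m : (n0 <= m)%N -> nm (sqrt_iter x m - sqrt_iter x n0) < e / 2.
    move=> hm; rewrite -(ltr_pM2r q1).
    apply: le_lt_trans (h n0 (leqnn _)); have := tele n0 (m - n0)%N; rewrite subnKC //.
    by have := exprn_ge0 m q0; lra.
  exists n0 => m n /hm am /hm an.
  have := nmD (sqrt_iter x m - sqrt_iter x n0) (sqrt_iter x n0 - sqrt_iter x n).
  by rewrite subrKA (nmB (sqrt_iter x n0)); lra.
have lq : nm l <= q.
  apply/ler_addgt0Pr => e e0; have [n h] := hl _ e0.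
  have := nmD (l - sqrt_iter x n) (sqrt_iter x n); rewrite subrK.
  by have := h n (leqnn _); have := yq n; lra.
have sl : SA l.
  by apply: (SA_lim sy) => e /hl[n h]; exists n; exact: h.
have fix_l : sqrt_step x l = l.
  apply/eqP; rewrite -subr_eq0; apply/eqP/nm0_eq0/eqP.
  rewrite eq_le nm_ge0 andbT; apply/ler_addgt0Pr => e e0; rewrite add0r.
  have [n h] := hl _ (divr_gt0 e0 (ltr0Sn R 1)).
  have := nmD (sqrt_step x l - sqrt_iter x n.+1) (sqrt_iter x n.+1 - l).
  rewrite subrKA (nmB (sqrt_iter x n.+1)).
  have := sqrt_stepB x l (sqrt_iter x n); have := h n (leqnn _).
  have := h n.+1 (leqnSn _); have := yq n; have := nm_ge0 (l - sqrt_iter x n).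
  rewrite -[sqrt_step x (sqrt_iter x n)]/(sqrt_iter x n.+1).
  move=> ? ? ?.
  have : 2^-1 * (nm l + nm (sqrt_iter x n)) * nm (l - sqrt_iter x n) <= 1 * nm (l - sqrt_iter x n).
    by rewrite ler_wpM2r ?nm_ge0 //; lra.
  lra.
exists (1 - l); split; first by apply: SAB => //; exact: SA1.
  by rewrite opprB addrC subrK; apply: le_trans lq (ltW x1).
have : real_of A 2 * sqrt_step x l = x + l ^+ 2.
  by rewrite /sqrt_step mulrA -rmorphM /= mulfV ?pnatr_eq0 // rmorph1 mul1r.
rewrite fix_l (_ : real_of A 2 = 2); last by rewrite rmorph_nat.
move=> h; rewrite -[x](addrK (l ^+ 2)) -h; ring.
Qed.

(** In spectral terms, a self-adjoint [a] is positive iff its spectrum lies in some interval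
    [0, 2t], that is, iff [a] is within [t] of the scalar [t]. In this form [PosD] is the triangle
    inequality. *)
Definition Pos a := SA a /\ exists t, nm (real_of A t - a) <= t.

Lemma Pos_SA a : Pos a -> SA a. Proof. by case. Qed.

Lemma Pos_real r : 0 <= r -> Pos (real_of A r).
Proof. by move=> r0; split; [exact: SAr|exists r; rewrite subrr nm0]. Qed.

Lemma PosD a b : Pos a -> Pos b -> Pos (a + b).
Proof.
move=> [sa [t ht]] [sb [u hu]]; split; first exact: SAD.
exists (t + u); rewrite rmorphD /= opprD addrACA.
by apply: le_trans (nmD _ _) _; apply: lerD.
Qed.

Lemma nm_real_ge0 r a : 0 <= r -> nm (real_of A r * a) = r * nm a.
Proof. by move=> r0; rewrite nm_real ger0_norm. Qed.

Lemma Pos_scale r a : 0 <= r -> Pos a -> Pos (real_of A r * a).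
Proof.
move=> r0 [sa [t ht]]; split; first by apply: SAM => //; exact: SAr.
exists (r * t); rewrite rmorphM /= -mulrBr nm_real_ge0 //.
exact: ler_wpM2l.
Qed.

(** For [x = (t - a) / (t + e)] one has [a + e = (t + e) (1 - x)], so [sqrt1B] applies; adding [e]
    is what makes [nm x] strictly less than 1. *)
Lemma Pos_sqrt a e : Pos a -> 0 < e ->
  exists s, [/\ SA s, Pos s & s ^+ 2 = a + real_of A e].
Proof.
move=> [sa [t ht]] e0; have t0 : 0 <= t by apply: le_trans ht; exact: nm_ge0.
have te : 0 < t + e by rewrite ltr_wpDl.
have [||s [ss s1 s2]] := @sqrt1B (real_of A (t + e)^-1 * (real_of A t - a)).
- by apply: SAM; [exact: SAr | apply: SAB => //; exact: SAr].
- rewrite nm_real_ge0 ?invr_ge0 ?(ltW te) // mulrC ltr_pdivrMr // mul1r.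
  by apply: le_lt_trans ht _; rewrite ltrDl.
have ps : Pos s by split => //; exists 1; rewrite rmorph1.
exists (real_of A (Num.sqrt (t + e)) * s); split.
- by apply: SAM => //; exact: SAr.
- by apply: Pos_scale => //; exact: sqrtr_ge0.
rewrite exprMn -rmorphXn /= sqr_sqrtr ?(ltW te) // s2 mulrBr mulr1 mulrA -rmorphM /=.
by rewrite mulfV ?gt_eqF // rmorph1 mul1r rmorphD /=; ring.
Qed.

(* Arens' inequality, by the C*-identity for [a + 'i b]. *)
Lemma nm_sqrD a b : SA a -> SA b -> nm (a ^+ 2) <= nm (a ^+ 2 + b ^+ 2).
Proof.
move=> sa sb; set j := scalar_of A 'i.
have j2 : j ^+ 2 = -1 by rewrite -rmorphXn /= sqr_i rmorphN1.
have jadj : adj j = - j by rewrite adj_scalar /= -rmorphN; congr scalar_of; simpc.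
set z : B := a + j * b.
have adjz : adj z = a - j * b by rewrite adjD adjM jadj sa sb; ring.
have -> : a ^+ 2 + b ^+ 2 = adj z * z.
  rewrite adjz /z; have -> : (a - j * b) * (a + j * b) = a ^+ 2 - j ^+ 2 * b ^+ 2 by ring.
  by rewrite j2; ring.
rewrite nm_sqr // nmadjM ler_pXn2r ?nnegrE ?nm_ge0 //.
have -> : a = real_of A 2^-1 * (adj z + z).
  have -> : adj z + z = real_of A 2 * a by rewrite adjz /z rmorph_nat; ring.
  by rewrite mulrA -rmorphM /= mulVf ?pnatr_eq0 // rmorph1 mul1r.
rewrite nm_half; have := nmD (adj z) z; rewrite nm_adj; lra.
Qed.

(** [t - a ^+ 2] is itself a square by [sqrt1B], so Arens' inequality bounds its norm by that of its
    sum with [a ^+ 2], the scalar [t]. *)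
Lemma nm_le_sqr a t : SA a -> nm (a ^+ 2) < t -> nm (real_of A t - a ^+ 2) <= t.
Proof.
move=> sa at_; have t0 : 0 < t by apply: le_lt_trans at_; exact: nm_ge0.
have [||c [sc _ c2]] := @sqrt1B (real_of A t^-1 * a ^+ 2).
- by apply: SAM; [exact: SAr | exact: SAX].
- by rewrite nm_real_ge0 ?invr_ge0 ?(ltW t0) // mulrC ltr_pdivrMr // mul1r.
have -> : real_of A t - a ^+ 2 = (real_of A (Num.sqrt t) * c) ^+ 2.
  rewrite exprMn -rmorphXn /= sqr_sqrtr ?(ltW t0) // c2 mulrBr mulr1 mulrA -rmorphM /=.
  by rewrite mulfV ?gt_eqF // rmorph1 mul1r.
have sr : SA (real_of A (Num.sqrt t) * c) by apply: SAM => //; exact: SAr.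
apply: le_trans (nm_sqrD sr sa) _.
rewrite exprMn -rmorphXn /= sqr_sqrtr ?(ltW t0) // c2 mulrBr mulr1 mulrA -rmorphM /=.
rewrite mulfV ?gt_eqF // rmorph1 mul1r subrK.
by have := nm_real_le A t; rewrite (ger0_norm (ltW t0)).
Qed.

Lemma Pos_sqr a : SA a -> Pos (a ^+ 2).
Proof.
move=> sa; split; first exact: SAX.
by exists (nm (a ^+ 2) + 1); apply: nm_le_sqr => //; rewrite ltrDl.
Qed.

(** The bound witnessing [Pos (a + e)] might grow as [e] tends to 0. But [a + e / 2] is a square of
    norm less than [nm a + 3] when [e <= 1], so the bound [nm a + 3] serves for all small [e]. *)
Lemma Pos_closed a : (forall e, 0 < e -> Pos (a + real_of A e)) -> Pos a.
Proof.
move=> h; have sa : SA a.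
  by have /Pos_SA := h _ ltr01; move/SAB => /(_ _ (SAr A 1)); rewrite addrK.
split=> //; exists (nm a + 3); apply/ler_addgt0Pr => e e0.
wlog e1 : e e0 / e <= 1.
  move=> H; have [e1|/ltW e1] := leP e 1; first exact: H e0 e1.
  by apply: le_trans (H _ ltr01 (lexx _)) _; rewrite lerD2l.
have e2 : 0 < e / 2 by rewrite divr_gt0.
have e4 : 0 < e / 2 / 2 by rewrite divr_gt0.
have [s [ss _ s2]] := Pos_sqrt (h _ e4) e4.
have ess : s ^+ 2 = a + real_of A (e / 2).
  rewrite s2 -addrA -rmorphD /=; congr (_ + real_of A _); lra.
have := nm_real_le A (e / 2); rewrite (ger0_norm (ltW e2)) => re.
have h1 : nm (s ^+ 2) < nm a + 3.
  by rewrite ess; have := nmD a (real_of A (e / 2)); lra.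
have := nm_le_sqr ss h1; rewrite ess => h2.
have := nmD (real_of A (nm a + 3) - (a + real_of A (e / 2))) (real_of A (e / 2)).
have -> : real_of A (nm a + 3) - (a + real_of A (e / 2)) + real_of A (e / 2) =
  real_of A (nm a + 3) - a by ring.
lra.
Qed.

Lemma PosM a b : Pos a -> Pos b -> Pos (a * b).
Proof.
move=> pa pb; apply: Pos_closed => e e0.
have n0 : 0 <= nm a + nm b + 1 by have := nm_ge0 a; have := nm_ge0 b; lra.
(* Chosen so that [d * nm (a + b) + d ^+ 2 <= e]. The product [(a + d) (b + d)] is a square, and the
   rest of [a * b + e], namely [e - d ^+ 2 - d (a + b)], is positive with bound [e - d ^+ 2]. *)
pose d := e / (nm a + nm b + 1 + e).
have dn : 0 < nm a + nm b + 1 + e by lra.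
have d0 : 0 < d by rewrite divr_gt0.
have de : d * (nm a + nm b + 1 + e) = e by rewrite mulfVK ?gt_eqF.
have d1 : d < 1 by rewrite /d ltr_pdivrMr // mul1r; have := nm_ge0 a; have := nm_ge0 b; lra.
have [s [ss _ s2]] := Pos_sqrt pa d0; have [s' [ss' _ s2']] := Pos_sqrt pb d0.
have -> : a * b + real_of A e = (s * s') ^+ 2 +
    (real_of A (e - d ^+ 2) - real_of A d * (a + b)).
  by rewrite exprMn s2 s2' rmorphB rmorphXn /=; ring.
apply: PosD; first by apply: Pos_sqr; exact: SAM.
split.
  apply: SAB; first exact: SAr.
  by apply: SAM; [exact: SAr | apply: SAD; exact: Pos_SA].
exists (e - d ^+ 2); rewrite opprB addrC subrK (nm_real_ge0 _ (ltW d0)).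
have := nmD a b; nra.
Qed.

(** Arens' inequality for square roots of [a] and [b], which exist once [e / 4] is added to each. *)
Lemma Pos_nmD a b : Pos a -> Pos b -> nm a <= nm (a + b).
Proof.
move=> pa pb; apply/ler_addgt0Pr => e e0.
have e4 : 0 < e / 4 by rewrite divr_gt0.
have [s [ss _ s2]] := Pos_sqrt pa e4; have [s' [ss' _ s2']] := Pos_sqrt pb e4.
have := nm_sqrD ss ss'; rewrite s2 s2'.
have := nm_real_le A (e / 4); rewrite (ger0_norm (ltW e4)) => re.
have := nmD (a + real_of A (e / 4)) (- real_of A (e / 4)); rewrite addrK nmN.
have := nmD (a + b) (real_of A (e / 4) + real_of A (e / 4)).
have := nmD (real_of A (e / 4)) (real_of A (e / 4)).
by rewrite addrACA; lra.
Qed.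

Lemma Pos_archi a : SA a -> Pos (real_of A (nm a) - a).
Proof.
move=> sa; split; first by apply: SAB => //; exact: SAr.
exists (nm a); by rewrite opprB addrC subrK.
Qed.

End PositiveCone.

(** * Preorderings and characters *)

Definition is_character (R : realType) (A : commCStarType R) (f : A -> R[i]) :=
  [/\ forall c a b, f (c *: a + b) = c * f a + f b, f cone = 1,
      forall a b, f (cmul a b) = f a * f b & forall a, f (star a) = (f a)^*].

Section Preorderings.
Variables (R : realType) (A : commCStarType R).
Local Notation B := (cstar_ring A).
Local Notation rl := (real_of A).
Implicit Types (a b x y s t : B) (e r : R) (T : set B).

(** The notion of real algebra, with [Pos] in the role of the sums of squares. *)
Definition preordering T := [/\ T `<=` @SA R A, @Pos R A `<=` T,
  (forall a b, T a -> T b -> T (a + b)), (forall a b, T a -> T b -> T (a * b)) &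
  ~ T (- 1)].

Definition preord_adjoin T x : set B :=
  [set a | exists s t, [/\ T s, T t & a = s + x * t]].

Lemma preordering_adjoin T x : preordering T -> SA x ->
  ~ preord_adjoin T x (- 1) -> preordering (preord_adjoin T x).
Proof.
move=> [TS PT TD TM T1] sx N1; split => //.
- move=> _ [s [t [/TS ss /TS st ->]]]; apply: SAD => //; exact: SAM.
- move=> p /PT Tp; exists p, 0; split => //; last by rewrite mulr0 addr0.
  by apply: PT; rewrite -(rmorph0 rl); exact: Pos_real.
- move=> _ _ [s [t [Ts Tt ->]]] [s' [t' [Ts' Tt' ->]]].
  exists (s + s'), (t + t'); split; [exact: TD|exact: TD|ring].
- move=> _ _ [s [t [Ts Tt ->]]] [s' [t' [Ts' Tt' ->]]].
  exists (s * s' + x ^+ 2 * (t * t')), (s * t' + s' * t); split; last by ring.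
  + apply: (TD); first exact: TM.
    by apply: (TM _ _ _ (TM _ _ Tt Tt')); apply/PT/Pos_sqr.
  + by apply: TD; exact: TM.
Qed.

Lemma sub_preord_adjoin T x : preordering T -> T `<=` preord_adjoin T x.
Proof.
move=> [_ PT _ _ _] s Ts; exists s, 0; split => //; last by rewrite mulr0 addr0.
by apply: PT; rewrite -(rmorph0 rl); exact: Pos_real.
Qed.

Lemma preord_adjoin_self T x : preordering T -> preord_adjoin T x x.
Proof.
move=> [_ PT _ _ _]; exists 0, 1; split; last by ring.
- by apply: PT; rewrite -(rmorph0 rl); exact: Pos_real.
- by apply: PT; rewrite -(rmorph1 rl); exact: Pos_real.
Qed.

(** The Artin-Schreier argument: if [-1 = s + x t] and [-1 = s' - x t'], then multiplying
    [-1 - s = x t] by [-1 - s' = - x t'] exhibits -1 as an element of [T]. *)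
Lemma preord_adjoin_or T x : preordering T -> SA x ->
  preordering (preord_adjoin T x) \/ preordering (preord_adjoin T (- x)).
Proof.
move=> pT sx; have [[s [t [Ts Tt e1]]]|] := pselect (preord_adjoin T x (- 1)); last first.
  by move=> h; left; exact: preordering_adjoin.
right; apply: preordering_adjoin => //; first exact: SAN.
move=> [s' [t' [Ts' Tt' e2]]].
case: (pT) => TS PT TD TM; apply.
have -> : -1 = s + s' + s * s' + x ^+ 2 * (t * t').
  have -> : x ^+ 2 * (t * t') = - ((x * t) * (- x * t')) by ring.
  have -> : x * t = - 1 - s by rewrite e1; ring.
  have -> : - x * t' = - 1 - s' by rewrite e2; ring.
  ring.
apply: (TD); first by apply: (TD); [exact: TD|exact: TM].
by apply: (TM _ _ _ (TM _ _ Tt Tt')); apply/PT/Pos_sqr.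
Qed.

Lemma preordering_max T0 : preordering T0 -> exists T, [/\ preordering T, T0 `<=` T &
  forall x, SA x -> T x \/ T (- x)].
Proof.
move=> pT0.
(* Zorn's lemma is applied to the sets whose union with [T0] is a preordering, so that the empty
   chain is no exception. *)
have [F FP Ftot|M [pM Mmax]] := @Zorn_bigcup B [set X | preordering (T0 `|` X)].
  rewrite /=; set U := T0 `|` _.
  have XU X : F X -> T0 `|` X `<=` U.
    by move=> FX z [|Xz]; [left|right; exists X].
  have two z w : U z -> U w -> exists X, [/\ preordering X, X `<=` U, X z & X w].
    move=> [Tz|[X FX Xz]] [Tw|[Y FY Yw]].
    - by exists T0; split => // u Tu; left.
    - by exists (T0 `|` Y); split; [exact: FP|exact: XU|left|right].
    - by exists (T0 `|` X); split; [exact: FP|exact: XU|right|left].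
    - have [XY|YX] := Ftot _ _ FX FY.
      + by exists (T0 `|` Y); split; [exact: FP|exact: XU|right; exact: XY|right].
      + by exists (T0 `|` X); split; [exact: FP|exact: XU|right|right; exact: YX].
  split.
  + by move=> z Uz; have [X [[XS _ _ _ _] _ Xz _]] := two _ _ Uz Uz; exact: XS.
  + by move=> p Pp; left; case: pT0 => _ + _ _ _; exact.
  + move=> z w Uz Uw; have [X [[_ _ XD _ _] XU' Xz Xw]] := two _ _ Uz Uw.
    by apply: XU'; exact: XD.
  + move=> z w Uz Uw; have [X [[_ _ _ XM _] XU' Xz Xw]] := two _ _ Uz Uw.
    by apply: XU'; exact: XM.
  + by move=> Uz; have [X [[_ _ _ _ X1] _ Xz _]] := two _ _ Uz Uz; exact: X1.
exists (T0 `|` M); split; [exact: pM|exact: subsetUl|].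
move=> x sx.
have key y : preordering (preord_adjoin (T0 `|` M) y) -> (T0 `|` M) y.
  move=> py; set E := preord_adjoin _ y in py.
  have ME : T0 `|` M `<=` E by exact: sub_preord_adjoin.
  have T0E : T0 `|` E = E by apply/setUidPr => z T0z; apply: ME; left.
  apply: contrapT => nMy; apply: (Mmax E); last by rewrite /= T0E.
  split; first by move=> z Mz; apply: ME; right.
  move=> EM; apply: nMy; right; apply: EM; exact: preord_adjoin_self.
by case: (preord_adjoin_or pM sx) => /key; [left|right].
Qed.

(** * The character defined by a total preordering *)

Section Character.
Variable T : set B.
Hypothesis pT : preordering T.
Hypothesis totT : forall x, SA x -> T x \/ T (- x).

Let TP p : Pos p -> T p. Proof. by case: pT => _ + _ _ _; exact. Qed.
Let TS p : T p -> SA p. Proof. by case: pT => + _ _ _ _; exact. Qed.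
Let TD a b : T a -> T b -> T (a + b). Proof. by case: pT => _ _ + _ _; exact. Qed.
Let TM a b : T a -> T b -> T (a * b). Proof. by case: pT => _ _ _ + _; exact. Qed.

Lemma preord_real r : T (rl r) -> 0 <= r.
Proof.
move=> Tr; rewrite leNgt; apply/negP => r0; case: pT => _ _ _ _; apply.
have -> : - 1 = rl (- r^-1) * rl r.
  by rewrite -rmorphM /= mulNr mulVf ?lt_eqF // rmorphN1.
by apply: TM => //; apply/TP/Pos_real; rewrite oppr_ge0 invr_le0 ltW.
Qed.

Definition chi a : R := sup [set r | T (a - rl r)].

Let chi_ub a r : SA a -> T (a - rl r) -> r <= nm a.
Proof.
move=> sa Tr; rewrite -subr_ge0; apply: preord_real.
have -> : rl (nm a - r) = (rl (nm a) - a) + (a - rl r) by rewrite rmorphB /=; ring.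
by apply: TD => //; apply/TP/Pos_archi.
Qed.

Let chi_has_sup a : SA a -> has_sup [set r | T (a - rl r)].
Proof.
move=> sa; split; last by exists (nm a) => r; exact: chi_ub.
exists (- nm a) => /=; rewrite rmorphN opprK addrC -{2}(opprK a) -nmN.
by apply/TP/Pos_archi; exact: SAN.
Qed.

(** The supremum need not be attained, as [T] is not assumed closed under limits; hence the margin
    [e]. The lower half comes from the supremum, the upper half from totality of [T]. *)
Lemma chi_approx a e : SA a -> 0 < e ->
  T (a - rl (chi a - e)) /\ T (rl (chi a + e) - a).
Proof.
move=> sa e0; split.
  have [r /= Tr er] := sup_adherent e0 (chi_has_sup sa).
  have -> : a - rl (chi a - e) = (a - rl r) + rl (r - (chi a - e)).
    by rewrite rmorphB /=; ring.
  by apply: TD => //; apply/TP/Pos_real; rewrite subr_ge0 ltW.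
have sae : SA (a - rl (chi a + e)) by apply: SAB => //; exact: SAr.
have [Te|] := totT sae; last by rewrite opprB.
have : chi a + e <= chi a by apply: sup_upper_bound Te; exact: chi_has_sup.
by rewrite gerDl leNgt e0.
Qed.

(** Adding opposite halves of the two sandwiches puts a scalar in [T], and scalars in [T] are
    nonnegative. This is how [chi] is computed on scalars, sums and nonnegative multiples. *)
Lemma chi_uniq a c : SA a ->
  (forall e, 0 < e -> T (a - rl (c - e)) /\ T (rl (c + e) - a)) -> chi a = c.
Proof.
move=> sa h; apply/eqP; rewrite eq_le; apply/andP; split; apply/ler_addgt0Pr => e e0.
  have e2 : 0 < e / 2 by rewrite divr_gt0.
  have [_ h1] := h _ e2; have [h2 _] := chi_approx sa e2.
  have := TD h1 h2; rewrite subrKA -rmorphB => /preord_real; lra.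
have e2 : 0 < e / 2 by rewrite divr_gt0.
have [h1 _] := h _ e2; have [_ h2] := chi_approx sa e2.
have := TD h2 h1; rewrite subrKA -rmorphB => /preord_real; lra.
Qed.

Lemma chi_ge0 a : T a -> 0 <= chi a.
Proof.
move=> Ta; apply: sup_upper_bound; first exact/chi_has_sup/TS.
by rewrite /= rmorph0 subr0.
Qed.

Lemma chi_real r : chi (rl r) = r.
Proof.
apply: chi_uniq => [|e e0]; first exact: SAr.
by split; rewrite -rmorphB; apply/TP/Pos_real; lra.
Qed.

Lemma chiD a b : SA a -> SA b -> chi (a + b) = chi a + chi b.
Proof.
move=> sa sb; apply: chi_uniq => [|e e0]; first exact: SAD.
have e2 : 0 < e / 2 by rewrite divr_gt0.
have [a1 a2] := chi_approx sa e2; have [b1 b2] := chi_approx sb e2; split.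
  have := TD a1 b1; congr T; rewrite addrACA -opprD -rmorphD /=.
  by congr (_ - rl _); lra.
have := TD a2 b2; congr T; rewrite addrACA -opprD -rmorphD /=.
by congr (rl _ - _); lra.
Qed.

Lemma chiN a : SA a -> chi (- a) = - chi a.
Proof.
move=> sa; apply/eqP; rewrite -addr_eq0 -chiD //; last exact: SAN.
by rewrite addNr -(rmorph0 rl) chi_real.
Qed.

Let chi_scale0 r a : SA a -> 0 <= r -> chi (rl r * a) = r * chi a.
Proof.
move=> sa; rewrite le_eqVlt => /predU1P[<-|r0].
  by rewrite rmorph0 !mul0r -(rmorph0 rl) chi_real.
apply: chi_uniq => [|e e0]; first by apply: SAM => //; exact: SAr.
have er : 0 < e / r by rewrite divr_gt0.
have [a1 a2] := chi_approx sa er; have Tr : T (rl r) by apply/TP/Pos_real/ltW.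
have re : r * (e / r) = e by rewrite mulrC divfK ?gt_eqF.
split.
  by have := TM Tr a1; rewrite mulrBr -rmorphM /= mulrBr re.
by have := TM Tr a2; rewrite mulrBr -rmorphM /= mulrDr re.
Qed.

Lemma chi_scale r a : SA a -> chi (rl r * a) = r * chi a.
Proof.
move=> sa; have [r0|/ltW r0] := leP 0 r; first exact: chi_scale0.
have -> : rl r * a = - (rl (- r) * a) by rewrite rmorphN /=; ring.
rewrite chiN ?chi_scale0 ?oppr_ge0 //; first by rewrite mulNr opprK.
by apply: SAM => //; exact: SAr.
Qed.

(** If [chi a = 0], then [a] lies between plus and minus the root of [e] for the order of [T]; the
    product of the two gaps is [e - a ^+ 2]. *)
Let chi_sqr0 a : SA a -> chi a = 0 -> chi (a ^+ 2) = 0.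
Proof.
move=> sa a0; apply: chi_uniq => [|e e0]; first exact: SAX.
split.
  rewrite sub0r rmorphN opprK; apply: TD; apply: TP; first exact: Pos_sqr.
  exact/Pos_real/ltW.
have se : 0 < Num.sqrt e by rewrite sqrtr_gt0.
have [a1 a2] := chi_approx sa se; have := TM a1 a2.
rewrite a0 !add0r rmorphN opprK; congr T.
rewrite -[e in RHS](sqr_sqrtr (ltW e0)) rmorphXn /=; ring.
Qed.

(** Centring [a] at [chi a] reduces to [chi_sqr0]; the remaining terms are affine in [a]. Products
    then follow by polarization. *)
Lemma chi_sqr a : SA a -> chi (a ^+ 2) = chi a ^+ 2.
Proof.
move=> sa; set c := chi a.
have sac : SA (a - rl c) by apply: SAB => //; exact: SAr.
have c0 : chi (a - rl c) = 0.
  by rewrite -rmorphN chiD ?chi_real ?subrr //; exact: SAr.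
have -> : a ^+ 2 = (a - rl c) ^+ 2 + (rl (2 * c) * a + rl (- c ^+ 2)).
  by rewrite rmorphN rmorphM rmorphXn /= rmorph_nat; ring.
have s1 : SA (rl (2 * c) * a) by apply: SAM => //; exact: SAr.
rewrite chiD; [|exact: SAX|by apply: SAD => //; exact: SAr].
rewrite chi_sqr0 // (chiD s1 (SAr _ _)) chi_real chi_scale // -/c; ring.
Qed.

Lemma chiM a b : SA a -> SA b -> chi (a * b) = chi a * chi b.
Proof.
move=> sa sb; have := chi_sqr (SAD sa sb).
have -> : (a + b) ^+ 2 = (a ^+ 2 + b ^+ 2) + rl 2 * (a * b) by rewrite rmorph_nat; ring.
have [[sab sa2] sb2] := (SAM sa sb, SAX 2 sa, SAX 2 sb).
have s3 : SA (rl 2 * (a * b)) by apply: SAM => //; exact: SAr.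
rewrite (chiD (SAD sa2 sb2) s3).
rewrite (chiD sa2 sb2) (chiD sa sb) chi_scale // !chi_sqr //; lra.
Qed.

Definition re_part (z : B) : B := rl 2^-1 * (z + adj z).
Definition im_part (z : B) : B := rl 2^-1 * (scalar_of A (- 'i) * (z - adj z)).

Definition chiC (z : A) : R[i] := chi (re_part z) +i* chi (im_part z).

Let J : B := scalar_of A 'i.
Let J2 : J ^+ 2 = -1. Proof. by rewrite -rmorphXn /= sqr_i rmorphN1. Qed.
Let adjJ : adj J = - J.
Proof. by rewrite adj_scalar /= -rmorphN; congr scalar_of; simpc. Qed.
Let half2 : rl 2^-1 * 2 = 1.
Proof. by rewrite -(rmorph_nat rl) -rmorphM /= mulVf ?pnatr_eq0 // rmorph1. Qed.

Lemma re_part_SA z : SA (re_part z).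
Proof. by rewrite /SA /re_part adjM adj_real adjD adjK (addrC z). Qed.

Lemma im_part_SA z : SA (im_part z).
Proof.
rewrite /SA /im_part rmorphN -/J !adjM adj_real adjN adjJ adjB adjK; ring.
Qed.

Lemma re_im z : z = re_part z + J * im_part z.
Proof.
rewrite /re_part /im_part rmorphN -/J.
have -> : rl 2^-1 * (z + adj z) + J * (rl 2^-1 * (- J * (z - adj z))) =
  rl 2^-1 * (z + adj z) - J ^+ 2 * (rl 2^-1 * (z - adj z)) by ring.
rewrite J2.
have -> : rl 2^-1 * (z + adj z) - -1 * (rl 2^-1 * (z - adj z)) = (rl 2^-1 * 2) * z by ring.
by rewrite half2 mul1r.
Qed.

Let adj_re_im a b : SA a -> SA b -> adj (a + J * b) = a - J * b.
Proof. by move=> sa sb; rewrite adjD adjM adjJ sa sb; ring. Qed.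

Lemma chiCE a b : SA a -> SA b -> chiC (a + J * b) = chi a +i* chi b.
Proof.
move=> sa sb; rewrite /chiC; congr (chi _ +i* chi _).
  rewrite /re_part adj_re_im //.
  have -> : a + J * b + (a - J * b) = 2 * a by ring.
  by rewrite mulrA half2 mul1r.
rewrite /im_part adj_re_im // rmorphN -/J.
have -> : - J * (a + J * b - (a - J * b)) = - J ^+ 2 * (2 * b) by ring.
by rewrite J2 opprK mul1r mulrA half2 mul1r.
Qed.

Let scalarE (c : R[i]) : scalar_of A c = rl (complex.Re c) + J * rl (complex.Im c).
Proof. by rewrite /J /real_of -rmorphM -rmorphD /=; congr scalar_of; exact: complexE. Qed.

Lemma chiC_character : is_character chiC.
Proof.
split.
- move=> c z w; rewrite scalar_ofE scalarE; set r := complex.Re c; set i := complex.Im c.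
  rewrite {1}(re_im z) {1}(re_im w).
  have [sa sb] := (re_part_SA z, im_part_SA z); have [sa' sb'] := (re_part_SA w, im_part_SA w).
  set a := re_part z in sa *; set b := im_part z in sb *.
  set a' := re_part w in sa' *; set b' := im_part w in sb' *.
  have -> : (rl r + J * rl i) * (a + J * b) + (a' + J * b') =
    (rl r * a + J ^+ 2 * (rl i * b) + a') + J * (rl r * b + rl i * a + b') by ring.
  have hS e y : SA y -> SA (rl e * y) by move=> sy; apply: SAM => //; exact: SAr.
  rewrite J2 mulN1r chiCE; last 2 first.
  + by apply: SAD => //; apply: SAB; exact: hS.
  + by apply: SAD => //; apply: SAD; exact: hS.
  rewrite /chiC -/a -/b -/a' -/b'; clearbody a b a' b'.
  rewrite !chiD ?chiN ?chi_scale //; try exact: hS; try (by apply: SAN; exact: hS);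
    try (by apply: SAD; exact: hS); try (by apply: SAB; exact: hS).
  rewrite /r /i; case: c @r @i => r i /=.
  by simpc; congr (_ +i* _); ring.
- have -> : (cone : A) = (1 + J * 0 : B) :> B by rewrite mulr0 addr0.
  rewrite chiCE; [|exact: SA1|exact: SA0].
  by rewrite -(rmorph1 rl) -(rmorph0 rl) !chi_real.
- move=> z w; rewrite -[cmul z w]/((z : B) * (w : B)) {1}(re_im z) {1}(re_im w).
  have [sa sb] := (re_part_SA z, im_part_SA z); have [sa' sb'] := (re_part_SA w, im_part_SA w).
  set a := re_part z in sa *; set b := im_part z in sb *.
  set a' := re_part w in sa' *; set b' := im_part w in sb' *.
  have -> : (a + J * b) * (a' + J * b') =
    (a * a' + J ^+ 2 * (b * b')) + J * (a * b' + b * a') by ring.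
  rewrite J2 mulN1r chiCE; last 2 first.
  + by apply: SAB; exact: SAM.
  + by apply: SAD; exact: SAM.
  rewrite /chiC -/a -/b -/a' -/b'; clearbody a b a' b'.
  rewrite !chiD ?chiN ?chiM //; try exact: SAM; try (by apply: SAN; exact: SAM).
- move=> z; rewrite -[star z]/(adj (z : B)) {1}(re_im z) adj_re_im;
    [|exact: re_part_SA|exact: im_part_SA].
  rewrite -mulrN chiCE; [|exact: re_part_SA|by apply: SAN; exact: im_part_SA].
  by rewrite chiN //; exact: im_part_SA.
Qed.

Lemma chiC_SA a : SA a -> chiC a = (chi a)%:C.
Proof.
move=> sa; have {1}-> : a = a + J * 0 by rewrite mulr0 addr0.
rewrite chiCE //; last exact: SA0.
by rewrite -(rmorph0 rl) chi_real.
Qed.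

End Character.

(** * Characters whose values come close to the norm *)

Lemma nm1_gt0 a : 0 < nm a -> 0 < nm (1 : B).
Proof.
move=> a0; rewrite lt_def nm_ge0 andbT; apply/eqP => /nm0_eq0 h.
by move: a0; rewrite -[a]mul1r h mul0r nm0 ltxx.
Qed.

(** If -1 were positive, [Pos_nmD] would give [nm 1 <= nm (1 - 1) = 0]. In the zero algebra -1 is
    indeed positive. *)
Lemma preordering_Pos : 0 < nm (1 : B) -> preordering (@Pos R A).
Proof.
move=> n1; split => //; [exact: Pos_SA|exact: PosD|exact: PosM|].
move=> PN; have P1 : Pos (1 : B) by rewrite -(rmorph1 rl); exact: Pos_real.
by have := Pos_nmD P1 PN; rewrite subrr nm0 leNgt n1.
Qed.

Lemma nm_sqr_pow2 a n : SA a -> nm (a ^+ (2 ^ n)) = nm a ^+ (2 ^ n).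
Proof.
move=> sa; elim: n => [|n ih]; first by rewrite !expr1.
by rewrite expnSr !exprM -ih nm_sqr //; exact: SAX.
Qed.

(* If [-1 = p + (a^2 - 1) q] then [q >= 1 + a^2 q], whence [q >= a^(2n)] for
   all [n], which is absurd when [nm a > 1]. *)
Lemma preordering_gt1 a : SA a -> 1 < nm a ->
  preordering (preord_adjoin (@Pos R A) (a ^+ 2 - 1)).
Proof.
move=> sa a1.
have n1 : 0 < nm (1 : B) by exact: nm1_gt0 (lt_trans ltr01 a1).
have P1 : Pos (1 : B) by rewrite -(rmorph1 rl); exact: Pos_real.
have sx : SA (a ^+ 2 - 1) by apply: SAB; [exact: SAX|exact: SA1].
apply: preordering_adjoin => //; first exact: preordering_Pos.
move=> [p [q [Pp Pq e]]].
have eq_q : q = 1 + p + a ^+ 2 * q.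
  have -> : 1 + p + a ^+ 2 * q = q + (p + (a ^+ 2 - 1) * q) - (-1) by ring.
  by rewrite -e; ring.
have Pa := Pos_sqr sa.
have dom n : exists2 r : B, Pos r & q = (a ^+ 2) ^+ n + r.
  elim: n => [|n [r Pr h]].
    exists (p + a ^+ 2 * q); last by rewrite expr0 addrA.
    by apply: PosD => //; exact: PosM.
  exists (1 + p + a ^+ 2 * r).
    by apply: PosD; [exact: PosD|exact: PosM].
  by rewrite {1}eq_q {1}h [(_ ^+ 2) ^+ n.+1]exprS; ring.
have Pan n : Pos ((a ^+ 2) ^+ n).
  elim: n => [|n ih]; first by rewrite expr0.
  by rewrite [X in Pos X]exprS; exact: PosM.
have bound k : nm a ^+ (2 ^ k.+1) <= nm q.
  have [r Pr ->] := dom (2 ^ k)%N.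
  by rewrite -nm_sqr_pow2 // expnS exprM; exact: Pos_nmD.
have ia : 0 <= (nm a)^-1 < 1 by rewrite invr_ge0 nm_ge0 invf_lt1 // (lt_trans ltr01).
(* Growth of the powers of [nm a] is read off the decay of the powers of its inverse. *)
have [|n0 h] := @expr_small _ _ (nm q + 1)^-1 ia.
  by rewrite invr_gt0 ltr_wpDl ?nm_ge0.
have := h (2 ^ n0.+1)%N; have -> : (n0 <= 2 ^ n0.+1)%N.
  by apply: (leq_trans (leqnSn n0)); apply: ltnW; exact: ltn_expl.
have ap : 0 < nm a ^+ (2 ^ n0.+1) by rewrite exprn_gt0 // (lt_trans ltr01).
rewrite exprVn ltf_pV2 ?posrE ?ltr_wpDl ?nm_ge0 // => /(_ isT).
by have := bound n0; lra.
Qed.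

Lemma character_gt1 a : SA a -> 1 < nm a ->
  exists2 f : A -> R[i], is_character f & 1 <= `|f a|.
Proof.
move=> sa a1; have [T [pT subT totT]] := preordering_max (preordering_gt1 sa a1).
exists (chiC T); first exact: chiC_character.
have Ta : T (a ^+ 2 - 1).
  by apply/subT/preord_adjoin_self/preordering_Pos/(nm1_gt0 (lt_trans ltr01 a1)).
have := chi_ge0 pT Ta.
rewrite -(rmorph1 rl) -rmorphN chiD ?chi_real //; [|exact: SAX|exact: SAr].
rewrite chi_sqr // chiC_SA // subr_ge0 normc_def /= expr0n addr0.
by move=> /ler_wsqrtr; rewrite sqrtr1 -lecR.
Qed.

Lemma character_large (a : B) r : 0 <= r < nm a ->
  exists2 f : A -> R[i], is_character f & r%:C <= `|f a|.
Proof.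
(* With [t] strictly between [r] and [nm a], the self-adjoint element [adj a * a / t ^+ 2] has norm
   above 1, and a character of modulus at least 1 on it has modulus at least [t] on [a]. *)
move=> /andP[r0 ra]; set t := (r + nm a) / 2.
have [rt ta] : r < t /\ t < nm a by rewrite /t; lra.
have t0 : 0 < t by apply: le_lt_trans rt.
have s0 : 0 < (t ^+ 2)^-1 by rewrite invr_gt0 exprn_gt0.
set b : B := rl (t ^+ 2)^-1 * (adj a * a).
have sb : SA b by rewrite /SA /b !adjM adjK adj_real (mulrC a).
have b1 : 1 < nm b.
  rewrite nm_real_ge0 ?(ltW s0) // nmadjM mulrC ltr_pdivlMr ?exprn_gt0 // mul1r.
  by rewrite ltr_pXn2r ?nnegrE ?nm_ge0 // ltW.
have [f cf f1] := character_gt1 sb b1; exists f => //.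
case: (cf) => fl _ fM fs.
have f0 : f 0 = 0.
  by have := fl 1 0 0; rewrite scale1r addr0 mul1r => /eqP; rewrite eq_sym -subr_eq0 addrK => /eqP.
have fb : f b = ((t ^+ 2)^-1)%:C * (`|f a| ^+ 2).
  have -> : b = ((t ^+ 2)^-1)%:C *: (adj a * a : A) :> A by rewrite scalar_ofE.
  have := fl ((t ^+ 2)^-1)%:C (adj a * a : A) 0; rewrite f0 !addr0 => ->.
  have := fM (star a) a; rewrite -[cmul _ _]/(adj a * a) => ->.
  by rewrite fs sqr_normc (mulrC (f a)).
move: f1; rewrite fb normrM normrX normr_id ger0_norm ?lecR ?(ltW s0) //.
rewrite rmorphV ?unitfE ?gt_eqF ?exprn_gt0 // mulrC ler_pdivlMr ?ltcR ?exprn_gt0 //.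
rewrite mul1r rmorphXn /= ler_pXn2r ?nnegrE ?normr_ge0 ?ler0c ?(ltW t0) //.
by move=> h; rewrite -lecR; apply: le_trans h; rewrite lecR ltW.
Qed.

(** * Characters are positive and contractive *)

Section CharacterTheory.
Variable f : A -> R[i].
Hypothesis cf : is_character f.

Let fl c a b : f (c *: a + b) = c * f a + f b. Proof. by case: cf. Qed.

Lemma char1 : f cone = 1. Proof. by case: cf. Qed.
Lemma charM a b : f (cmul a b) = f a * f b. Proof. by case: cf. Qed.
Lemma char_star a : f (star a) = (f a)^*. Proof. by case: cf. Qed.
Lemma charD a b : f (a + b) = f a + f b.
Proof. by have := fl 1 a b; rewrite scale1r mul1r. Qed.
Lemma char0 : f 0 = 0.
Proof. by apply: (addIr (f 0)); rewrite -charD !add0r. Qed.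
Lemma charZ c a : f (c *: a) = c * f a.
Proof. by have := fl c a 0; rewrite !addr0 char0 addr0. Qed.
Lemma charN a : f (- a) = - f a.
Proof. by apply/eqP; rewrite -addr_eq0 -charD addNr char0. Qed.
Lemma charB a b : f (a - b) = f a - f b.
Proof. by rewrite charD charN. Qed.

Lemma char_real r : f (rl r) = r%:C.
Proof. by rewrite /real_of /scalar_of charZ char1 mulr1. Qed.

Lemma char_SA a : SA a -> complex.Im (f a) = 0.
Proof.
move=> sa; have := char_star a; rewrite -[star a]/(adj (a : B)) sa.
by case: (f a) => x y /= [] /eqP; rewrite -addr_eq0 -mulr2n mulrn_eq0 => /eqP.
Qed.

(** [a + e] is the square of a self-adjoint element, on which [f] is real; hence [f a + e >= 0] for
    every [e > 0]. *)
Lemma char_Pos a : Pos a -> 0 <= f a.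
Proof.
move=> Pa; rewrite lecE (char_SA (Pos_SA Pa)) eqxx /=; apply/ler_addgt0Pr => e e0.
have [s [ss _ s2]] := Pos_sqrt Pa e0.
have := charD a (rl e); rewrite -s2 char_real -[s ^+ 2]/(cmul (s : A) s) charM.
move: (char_SA ss); case: (f s) (f a) => x y [u v] /= ->.
case=> h _; have := sqr_ge0 x; rewrite expr2; lra.
Qed.

(** For [b = adj a * a] the element [nm b - b] is positive, while [f b] is the squared modulus of
    [f a]. *)
Lemma char_le a : `|f a| <= `|a|.
Proof.
rewrite -(@ler_pXn2r _ 2) ?nnegrE //.
have -> : `|a| ^+ 2 = (nm (adj a * a))%:C :> R[i].
  by rewrite nmadjM rmorphXn /= -nmE.
rewrite sqr_normc mulrC -char_star -charM -[cmul _ _]/(adj (a : B) * a).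
set b := adj a * a; have sb : SA b by rewrite /SA /b adjM adjK mulrC.
by have := char_Pos (Pos_archi sb); rewrite charB char_real subr_ge0.
Qed.

End CharacterTheory.

End Preorderings.

(** * The topology of the complex numbers *)

HB.instance Definition _ (R : realType) :=
  NormedModule.copy R[i] ((R[i] : numFieldType) : Type).

Section ComplexTopology.
Variable R : realType.
Implicit Types (z w : R[i]) (e : R).

Lemma ltcC z : 0 < z -> exists2 e : R, 0 < e & z = e%:C.
Proof.
case: z => x y; rewrite ltcE /= => /andP[/eqP -> x0]; by exists x.
Qed.

Lemma normc_Re z : `|complex.Re z|%:C <= `|z|.
Proof. exact: normc_ge_Re. Qed.

Lemma normc_real (r : R) : `|r%:C| = `|r|%:C.
Proof. by rewrite normc_def /= expr0n /= addr0 sqrtr_sqr. Qed.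

Lemma normc_Im z : `|complex.Im z|%:C <= `|z|.
Proof.
rewrite normc_def lecR -sqrtr_sqr; apply: ler_wsqrtr.
by rewrite lerDr sqr_ge0.
Qed.

Lemma normc_le_ReIm z : `|z| <= (`|complex.Re z| + `|complex.Im z|)%:C.
Proof.
rewrite {1}(complexE z) rmorphD /= (le_trans (ler_normD _ _)) // normrM !normc_real.
have -> : `|'i| = 1 :> R[i] by rewrite normc_def /= expr0n expr1n /= add0r sqrtr1.
by rewrite mul1r.
Qed.

Lemma Re_continuous : continuous (@complex.Re R : R[i] -> R).
Proof.
move=> z; apply/(@cvgrPdist_lt _ _ _ (nbhs z)) => e e0; have eC : 0 < e%:C by rewrite ltcR.
apply: (@filterS _ (nbhs (z : R[i])) _ _ _ _ (nbhsx_ballx z e%:C eC)) => w.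
rewrite -ball_normE /= => zw.
rewrite -ltcR; apply: le_lt_trans zw.
by apply: le_trans (normc_Re _); rewrite raddfB.
Qed.

Lemma Im_continuous : continuous (@complex.Im R : R[i] -> R).
Proof.
move=> z; apply/(@cvgrPdist_lt _ _ _ (nbhs z)) => e e0; have eC : 0 < e%:C by rewrite ltcR.
apply: (@filterS _ (nbhs (z : R[i])) _ _ _ _ (nbhsx_ballx z e%:C eC)) => w.
rewrite -ball_normE /= => zw.
rewrite -ltcR; apply: le_lt_trans zw.
by apply: le_trans (normc_Im _); rewrite raddfB.
Qed.

Lemma cvg_complex (T : Type) (F : set_system T) (FF : Filter F) (f g : T -> R) (a b : R) :
  f @ F --> a -> g @ F --> b -> (fun x => f x +i* g x) @ F --> a +i* b.
Proof.
move=> /cvgrPdist_lt fa /cvgrPdist_lt gb; apply/cvgrPdist_lt => _ /ltcC[e e0 ->].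
have e2 : 0 < e / 2 by rewrite divr_gt0.
apply: filterS2 (fa _ e2) (gb _ e2) => x hf hg.
apply: le_lt_trans (normc_le_ReIm _) _; rewrite ltcR /=; lra.
Qed.

Lemma complex_closed_ball_compact (M : R) : compact [set z : R[i] | `|z| <= M%:C].
Proof.
have cont : continuous (fun p : R * R => (p.1 +i* p.2 : R[i])).
  by move=> p; apply: cvg_complex; [exact: cvg_fst|exact: cvg_snd].
have cK := compact_setX (@segment_compact R (- M) M) (@segment_compact R (- M) M).
apply: (subclosed_compact _ (continuous_compact (continuous_subspaceT cont) cK)).
  rewrite (_ : [set z | _] = (fun z : R[i] => complex.Re `|z|) @^-1` [set r | r <= M]).
    apply: preimage_closed; last exact: closed_le.
    move=> z _; apply: (@continuous_comp R[i] R[i] R (fun w => `|w|) (@complex.Re R)).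
      exact: (@norm_continuous _ R[i]).
    exact: Re_continuous.
  by apply/funext => z; rewrite /preimage /mkset -lecR RRe_real // ger0_real.
move=> z /= zM; exists (complex.Re z, complex.Im z); last by case: z {zM}.
have := le_trans (normc_Re z) zM; have := le_trans (normc_Im z) zM.
by rewrite !lecR !ler_norml => hi hr; split; rewrite /= in_itv.
Qed.

(** A Cauchy filter contains a ball of radius 1, and that ball lies in a compact disc. *)
Lemma complex_complete (F : set_system R[i]) : ProperFilter F -> cauchy F -> cvg F.
Proof.
move=> FF cF.
have /cauchyP/(_ _ ltr01)[z Fz] := cF.
have [M zM] : exists M : R, `|z| + 1 = M%:C.
  have /complex_realP[M zM] : `|z| + 1 \is Num.real by rewrite realE addr_ge0.
  by exists M.
apply: (compact_cauchy_cvg FF cF _ (@complex_closed_ball_compact M)).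
apply: filterS Fz => w; rewrite -ball_normE => zw; rewrite /mkset -zM.
rewrite -[w](subrK z) addrC; apply: le_trans (ler_normD _ _) _.
by rewrite lerD2l -normrN opprB; exact: ltW.
Qed.

End ComplexTopology.

(** * The C*-algebra of bounded continuous functions on a subset *)

Section ContinuousComplex.
Variables (R : realType) (T : topologicalType).
Implicit Types f g : T -> R[i].

Lemma continuousCD f g : continuous f -> continuous g -> continuous (fun x => f x + g x).
Proof. by move=> cf cg x; apply: cvgD; [exact: cf|exact: cg]. Qed.

Lemma continuousCM f g : continuous f -> continuous g -> continuous (fun x => f x * g x).
Proof. by move=> cf cg x; apply: cvgM; [exact: cf|exact: cg]. Qed.

Lemma continuous_complex (f g : T -> R) : continuous f -> continuous g ->
  continuous (fun x => f x +i* g x).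
Proof. by move=> cf cg x; apply: cvg_complex; [exact: cf|exact: cg]. Qed.

Lemma continuous_Re f : continuous f -> continuous (fun x => complex.Re (f x)).
Proof.
move=> cf x; apply: (@continuous_comp T R[i] R f (@complex.Re R)); first exact: cf.
exact: Re_continuous.
Qed.

Lemma continuous_Im f : continuous f -> continuous (fun x => complex.Im (f x)).
Proof.
move=> cf x; apply: (@continuous_comp T R[i] R f (@complex.Im R)); first exact: cf.
exact: Im_continuous.
Qed.

Lemma continuousCJ f : continuous f -> continuous (fun x => (f x)^*).
Proof.
move=> cf; rewrite (_ : (fun x => _) = fun x => complex.Re (f x) +i* - complex.Im (f x)).
  apply: continuous_complex; first exact: continuous_Re.
  by move=> x; apply: cvgN; apply: continuous_Im.
by apply/funext => x; case: (f x).
Qed.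

Lemma continuous_unif_lim (l : T -> R[i]) :
  (forall e : R, 0 < e -> exists2 f : T -> R[i], continuous f &
     forall x, `|f x - l x| <= e%:C) -> continuous l.
Proof.
move=> h x; apply/cvgrPdist_lt => _ /ltcC[e e0 ->].
have e4 : 0 < e / 4 by rewrite divr_gt0.
have [f cf fl] := h _ e4.
have /cvgrPdist_lt/(_ (e / 4)%:C) := cf x; rewrite ltcR => /(_ e4).
apply: filterS => y fxy.
have -> : l x - l y = - (f x - l x) + ((f x - f y) + (f y - l y)) by ring.
apply: le_lt_trans (ler_normD _ _) _; rewrite normrN.
apply: le_lt_trans (lerD (fl x) (ler_normD _ _)) _.
apply: le_lt_trans (lerD (lexx _) (lerD (ltW fxy) (fl y))) _.
by rewrite -!rmorphD /= ltcR; lra.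
Qed.

End ContinuousComplex.

(* Functions on [S] are extended by zero to [K], which avoids subtypes and puts
   the sections over different open sets on a common carrier. *)
Record bcfun (R : realType) (K : topologicalType) (S : set K) := BCFun {
  bcval :> K -> R[i];
  bc_continuous : {within S, continuous bcval};
  bc_off : forall x, ~ S x -> bcval x = 0;
  bc_bounded : exists M : R, forall x, `|bcval x| <= M%:C }.

Section BCFun.
Variables (R : realType) (K : topologicalType) (S : set K).
Local Notation C := (bcfun R S).
Implicit Types (f g h : C) (c : R[i]).

Lemma bcfun_eq f g : f =1 g -> f = g.
Proof.
case: f g => [f f1 f2 f3] [g g1 g2 g3] /= /funext fg; subst g.
by congr BCFun; exact: Prop_irrelevance.
Qed.

HB.instance Definition _ := gen_eqMixin C.
HB.instance Definition _ := gen_choiceMixin C.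

Definition indic_fun (B : set K) (u : K -> R[i]) : K -> R[i] :=
  fun x => if `[< B x >] then u x else 0.

Lemma indic_funT B u x : B x -> indic_fun B u x = u x.
Proof. by move=> Bx; rewrite /indic_fun asboolT. Qed.
Lemma indic_funF B u x : ~ B x -> indic_fun B u x = 0.
Proof. by move=> Bx; rewrite /indic_fun asboolF. Qed.

Lemma indic_fun_continuous (B : set K) u :
  {within B, continuous u} -> {within B, continuous (indic_fun B u)}.
Proof.
apply: subspace_eq_continuous => x; rewrite inE => Bx.
exact: esym (indic_funT u Bx).
Qed.

Fact bc0_subproof : (exists M : R, forall x : K, `|(0 : R[i])| <= M%:C).
Proof. by exists 0 => x; rewrite normr0. Qed.
Definition bc0 : C := @BCFun R K S (fun=> 0)
  (fun x => @cst_continuous (subspace S) R[i] 0 x) (fun _ _ => erefl) bc0_subproof.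

Fact bcN_bounded f : exists M : R, forall x, `|- f x| <= M%:C.
Proof. by have [M h] := bc_bounded f; exists M => x; rewrite normrN. Qed.
Fact bcN_continuous f : {within S, continuous (fun x => - f x)}.
Proof. by move=> x; apply: cvgN; apply: bc_continuous. Qed.
Fact bcN_off f x : ~ S x -> - f x = 0.
Proof. by move=> /bc_off ->; rewrite oppr0. Qed.
Definition bcN f : C := BCFun (@bcN_continuous f) (@bcN_off f) (bcN_bounded f).

Fact bcD_bounded f g : exists M : R, forall x, `|f x + g x| <= M%:C.
Proof.
have [M hf] := bc_bounded f; have [M' hg] := bc_bounded g; exists (M + M') => x.
by rewrite rmorphD /= (le_trans (ler_normD _ _)) // lerD.
Qed.
Fact bcD_continuous f g : {within S, continuous (fun x => f x + g x)}.
Proof. exact: continuousCD (@bc_continuous _ _ _ f) (@bc_continuous _ _ _ g). Qed.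
Fact bcD_off f g x : ~ S x -> f x + g x = 0.
Proof. by move=> Sx; rewrite !bc_off // addr0. Qed.
Definition bcD f g : C := BCFun (@bcD_continuous f g) (@bcD_off f g) (bcD_bounded f g).

Fact bcM_bounded f g : exists M : R, forall x, `|f x * g x| <= M%:C.
Proof.
have [M hf] := bc_bounded f; have [M' hg] := bc_bounded g; exists (M * M') => x.
by rewrite rmorphM /= normrM ler_pM.
Qed.
Fact bcM_continuous f g : {within S, continuous (fun x => f x * g x)}.
Proof. exact: continuousCM (@bc_continuous _ _ _ f) (@bc_continuous _ _ _ g). Qed.
Fact bcM_off f g x : ~ S x -> f x * g x = 0.
Proof. by move=> Sx; rewrite bc_off // mul0r. Qed.
Definition bcM f g : C := BCFun (@bcM_continuous f g) (@bcM_off f g) (bcM_bounded f g).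

Fact bcZ_bounded c f : exists M : R, forall x, `|c * f x| <= M%:C.
Proof.
have [M hf] := bc_bounded f; exists (complex.Re `|c| * M) => x.
by rewrite rmorphM /= normrM ler_pM // RRe_real ?ger0_real.
Qed.
Fact bcZ_continuous c f : {within S, continuous (fun x => c * f x)}.
Proof.
apply: continuousCM (@bc_continuous _ _ _ f).
by move=> x; exact: (@cst_continuous (subspace S) R[i] c x).
Qed.
Fact bcZ_off c f x : ~ S x -> c * f x = 0.
Proof. by move=> Sx; rewrite bc_off // mulr0. Qed.
Definition bcZ c f : C := BCFun (@bcZ_continuous c f) (@bcZ_off c f) (bcZ_bounded c f).

Fact bcJ_bounded f : exists M : R, forall x, `|(f x)^*| <= M%:C.
Proof. by have [M h] := bc_bounded f; exists M => x; rewrite normcJ. Qed.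
Fact bcJ_continuous f : {within S, continuous (fun x => (f x)^*)}.
Proof. exact: continuousCJ (@bc_continuous _ _ _ f). Qed.
Fact bcJ_off f x : ~ S x -> (f x)^* = 0.
Proof. by move=> /bc_off ->; rewrite conjc0. Qed.
Definition bcJ f : C := BCFun (@bcJ_continuous f) (@bcJ_off f) (bcJ_bounded f).

Fact bc1_bounded : exists M : R, forall x, `|indic_fun S (fun=> 1) x| <= M%:C.
Proof.
by exists 1 => x; rewrite /indic_fun; case: ifP; rewrite ?normr1 ?normr0 ?ler01.
Qed.
Definition bc1 : C := BCFun
  (@indic_fun_continuous S _ (fun x => @cst_continuous (subspace S) R[i] 1 x))
  (@indic_funF S (fun=> 1)) bc1_bounded.

Fact bcDA : associative bcD.
Proof. by move=> f g h; apply: bcfun_eq => x /=; rewrite addrA. Qed.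
Fact bcDC : commutative bcD.
Proof. by move=> f g; apply: bcfun_eq => x /=; rewrite addrC. Qed.
Fact bc0D : left_id bc0 bcD.
Proof. by move=> f; apply: bcfun_eq => x /=; rewrite add0r. Qed.
Fact bcND : left_inverse bc0 bcN bcD.
Proof. by move=> f; apply: bcfun_eq => x /=; rewrite addNr. Qed.

HB.instance Definition _ := GRing.isZmodule.Build C bcDA bcDC bc0D bcND.

Fact bcZA a b f : bcZ a (bcZ b f) = bcZ (a * b) f.
Proof. by apply: bcfun_eq => x /=; rewrite mulrA. Qed.
Fact bc1Z : left_id 1 bcZ.
Proof. by move=> f; apply: bcfun_eq => x /=; rewrite mul1r. Qed.
Fact bcZDr : right_distributive bcZ +%R.
Proof. by move=> c f g; apply: bcfun_eq => x /=; rewrite mulrDr. Qed.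
Fact bcZDl f : {morph bcZ^~ f : a b / a + b}.
Proof. by move=> a b; apply: bcfun_eq => x /=; rewrite mulrDl. Qed.

HB.instance Definition _ := GRing.Zmodule_isLmodule.Build R[i] C bcZA bc1Z bcZDr bcZDl.

Definition bsup f : R := sup (range (fun x => complex.Re `|f x|)).

Lemma Re_norm (z : R[i]) : (complex.Re `|z|)%:C = `|z|.
Proof. by rewrite RRe_real ?ger0_real. Qed.

Lemma bsup_ub f x : `|f x| <= (bsup f)%:C.
Proof.
rewrite -Re_norm lecR; apply: sup_upper_bound; last by exists x.
split; first by exists (complex.Re `|f x|), x.
by have [M h] := bc_bounded f; exists M => _ [y _ <-]; rewrite -lecR Re_norm.
Qed.

Lemma bsup_le f M : 0 <= M -> (forall x, `|f x| <= M%:C) -> bsup f <= M.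
Proof.
(* [K] may be empty; the supremum of the empty set is 0, whence the hypothesis [0 <= M]. *)
move=> M0 h; have [e|/set0P ne] := eqVneq (range (fun x => complex.Re `|f x|)) set0.
  by rewrite /bsup e sup0.
by apply: ge_sup => // _ [x _ <-]; rewrite -lecR Re_norm.
Qed.

Lemma bsup_ge0 f : 0 <= bsup f.
Proof.
have [e|/set0P[_ [x _ _]]] := eqVneq (range (fun x => complex.Re `|f x|)) set0.
  by rewrite /bsup e sup0.
by rewrite -ler0c; apply: le_trans (bsup_ub f x).
Qed.

Definition bcnorm f : R[i] := (bsup f)%:C.

Fact bcnormD f g : bcnorm (f + g) <= bcnorm f + bcnorm g.
Proof.
rewrite /bcnorm -rmorphD lecR; apply: bsup_le; first by rewrite addr_ge0 ?bsup_ge0.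
move=> x; rewrite rmorphD /=; apply: le_trans (ler_normD _ _) _.
by apply: lerD; exact: bsup_ub.
Qed.

Lemma bsupZ_le c f : bsup (c *: f) <= complex.Re `|c| * bsup f.
Proof.
apply: bsup_le => [|x]; first by rewrite mulr_ge0 ?bsup_ge0 // -ler0c Re_norm.
by rewrite rmorphM /= normrM ler_pM // ?Re_norm // bsup_ub.
Qed.

Fact bcnormZ c f : bcnorm (c *: f) = `|c| * bcnorm f.
Proof.
rewrite -[`|c|]Re_norm /bcnorm -rmorphM; congr (_%:C); apply/eqP.
rewrite eq_le bsupZ_le andTb; have [->|c0] := eqVneq c 0.
  by rewrite normr0 mul0r bsup_ge0.
have cp : 0 < complex.Re `|c| by rewrite -ltcR Re_norm normr_gt0.
have := bsupZ_le c^-1 (c *: f); rewrite scalerA mulVf // scale1r.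
have -> : complex.Re `|c^-1| = (complex.Re `|c|)^-1.
  apply: complexI; rewrite Re_norm normrV ?unitfE // -[in LHS]Re_norm.
  by rewrite -rmorphV ?unitfE ?gt_eqF.
by rewrite ler_pdivlMl.
Qed.

Fact bcnorm0_eq0 f : bcnorm f = 0 -> f = 0.
Proof.
move=> f0; apply: bcfun_eq => x; apply/normr0_eq0/eqP.
by rewrite eq_le normr_ge0 andbT -f0 bsup_ub.
Qed.

HB.instance Definition _ := Lmodule_isNormed.Build R[i] C bcnormD bcnormZ bcnorm0_eq0.

Lemma bcnormE f : `|f| = (bsup f)%:C. Proof. by []. Qed.

Lemma bc_le_norm f x : `|f x| <= `|f|. Proof. exact: bsup_ub. Qed.

Lemma bc_norm_le f (M : R) : 0 <= M -> (forall x, `|f x| <= M%:C) -> `|f| <= M%:C.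
Proof. by move=> M0 h; rewrite bcnormE lecR; exact: bsup_le. Qed.

(** The limit is taken pointwise; the Cauchy condition in norm makes the convergence uniform, which
    gives continuity and boundedness. *)
Lemma bc_complete (F : set_system C) : ProperFilter F -> cauchy F -> cvg F.
Proof.
move=> FF /cauchyP cF.
have near_e (e : R) : 0 < e -> exists f, \forall g \near F, `|f - g| < e%:C.
  by rewrite -ltcR => /cF[f Ff]; exists f; apply: filterS Ff => g; rewrite -ball_normE.
have evB f g x : `|f x - g x| <= `|f - g| by exact: (bc_le_norm (f - g) x).
have /choice[l lP] : forall x, exists z : R[i], (fun f : C => f x) @ F --> z.
  move=> x; apply/cvg_ex; apply: complex_complete; apply/(@cauchyP _ R[i]) => _ /ltcC[e e0 ->].
  have [f hf] := near_e _ e0; exists (f x); rewrite -ball_normE.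
  by apply: filterS hf => g; apply: le_lt_trans; exact: evB.
have unif (e : R) : 0 < e -> F [set f : C | forall x, `|f x - l x| <= e%:C].
  move=> e0; have e2 : 0 < e / 2 by rewrite divr_gt0.
  have [f0 hf0] := near_e _ e2; apply: (filterS _ hf0) => f ff0 x.
  apply/ler_addgt0Pr => _ /ltcC[d d0 ->].
  have /cvgrPdist_lt/(_ d%:C) := lP x; rewrite ltcR => /(_ d0) ld.
  have [g [hg hd]] := filter_ex (filterI hf0 ld).
  have -> : f x - l x = - (f0 x - f x) + ((f0 x - g x) - (l x - g x)) by ring.
  apply: le_trans (ler_normD _ _) _; rewrite normrN.
  apply: le_trans (lerD (le_trans (evB _ _ _) (ltW ff0)) (ler_normB _ _)) _.
  apply: le_trans (lerD (lexx _) (lerD (le_trans (evB _ _ _) (ltW hg)) (ltW hd))) _.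
  by rewrite -!rmorphD lecR /=; lra.
have lcont : {within S, continuous l}.
  apply: continuous_unif_lim => e /unif/filter_ex[f hf].
  exists (f : K -> R[i]).
    by move=> x; apply: (@bc_continuous _ _ _ f).
  by move=> x; apply: (hf x).
have loff x : ~ S x -> l x = 0.
  move=> Sx; have c0 : (fun f : C => f x) @ F --> (0 : R[i]).
    rewrite (_ : (fun f : C => f x) = fun=> 0); first exact: cvg_cst.
    by apply/funext => f; exact: bc_off.
  exact: (cvg_unique (@norm_hausdorff _ R[i]) (lP x) c0).
have lbd : exists M : R, forall x, `|l x| <= M%:C.
  have /filter_ex[f hf] := unif _ ltr01; have [M hM] := bc_bounded f.
  exists (M + 1) => x; rewrite -[l x](subKr (f x)) rmorphD /=.
  by apply: le_trans (ler_normB _ _) _; apply: lerD.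
apply/cvg_ex; exists (BCFun lcont loff lbd); apply/cvgrPdist_lt => _ /ltcC[e e0 ->].
have e2 : 0 < e / 2 by rewrite divr_gt0.
apply: filterS (unif _ e2) => f hf; apply: (@le_lt_trans _ _ (e / 2)%:C); last first.
  by rewrite ltcR; lra.
by apply: bc_norm_le => [|x]; [exact: ltW | rewrite distrC; exact: hf].
Unshelve. all: by end_near. Qed.

HB.instance Definition _ := Uniform_isComplete.Build C bc_complete.

Fact bcMA : associative bcM.
Proof. by move=> f g h; apply: bcfun_eq => x /=; rewrite mulrA. Qed.
Fact bcMC : commutative bcM.
Proof. by move=> f g; apply: bcfun_eq => x /=; rewrite mulrC. Qed.
Fact bc1M : left_id bc1 bcM.
Proof.
move=> f; apply: bcfun_eq => x /=; rewrite /indic_fun; case: asboolP => Sx.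
  by rewrite mul1r.
by rewrite mul0r bc_off.
Qed.
Fact bcMDl : left_distributive bcM +%R.
Proof. by move=> f g h; apply: bcfun_eq => x /=; rewrite mulrDl. Qed.
Fact bcMZl c f g : bcM (c *: f) g = c *: bcM f g.
Proof. by apply: bcfun_eq => x /=; rewrite mulrA. Qed.
Fact bcJK : involutive bcJ.
Proof. by move=> f; apply: bcfun_eq => x /=; rewrite conjcK. Qed.
Fact bcJD : {morph bcJ : f g / f + g}.
Proof. by move=> f g; apply: bcfun_eq => x /=; rewrite rmorphD. Qed.
Fact bcJZ c f : bcJ (c *: f) = c^* *: bcJ f.
Proof. by apply: bcfun_eq => x /=; rewrite rmorphM. Qed.
Fact bcJM f g : bcJ (bcM f g) = bcM (bcJ g) (bcJ f).
Proof. by apply: bcfun_eq => x /=; rewrite rmorphM mulrC. Qed.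
Fact bcnormM f g : `|bcM f g| <= `|f| * `|g|.
Proof.
rewrite !bcnormE -rmorphM lecR; apply: bsup_le => [|x].
  by rewrite mulr_ge0 ?bsup_ge0.
by rewrite rmorphM /= normrM ler_pM // bsup_ub.
Qed.
Fact bcnormJ f : `|bcM (bcJ f) f| = `|f| ^+ 2.
Proof.
have hx x : `|bcM (bcJ f) f x| = `|f x| ^+ 2 by rewrite /= normrM normcJ.
rewrite !bcnormE -rmorphXn /=; congr (_%:C); apply/eqP; rewrite eq_le; apply/andP; split.
  apply: bsup_le => [|x]; first by rewrite exprn_ge0 ?bsup_ge0.
  by rewrite hx rmorphXn /= lerXn2r ?nnegrE ?bsup_ub // ler0c bsup_ge0.
rewrite -[leRHS]sqr_sqrtr ?bsup_ge0 // lerXn2r ?nnegrE ?bsup_ge0 ?sqrtr_ge0 //.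
apply: bsup_le => [|x]; first exact: sqrtr_ge0.
rewrite -(@ler_pXn2r _ 2) ?nnegrE ?normr_ge0 ?ler0c ?sqrtr_ge0 //.
by rewrite -[in leRHS]rmorphXn sqr_sqrtr ?bsup_ge0 // -hx; exact: bsup_ub.
Qed.

HB.instance Definition _ := isCommCStarAlgebra.Build R C bcMA bcMC bc1M bcMDl
  bcMZl bcJK bcJD bcJZ bcJM bcnormM bcnormJ.

End BCFun.

(** * The spectrum *)

(** Were all members nonempty, they would generate a proper filter, and a cluster point of it would
    lie in every closed [B i]. This is the compactness step of both halves of Stone-Weierstrass and
    of [eval_surj]. *)
Lemma compact_directed (X : topologicalType) (I : Type) (D : set I) (B : I -> set X) :
  compact [set: X] -> D !=set0 -> (forall i, D i -> closed (B i)) ->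
  (forall i j, D i -> D j -> exists2 k, D k & B k `<=` B i `&` B j) ->
  (forall x, exists2 i, D i & ~ B i x) -> exists2 i, D i & B i = set0.
Proof.
move=> cX D0 cB dir sep; apply: contrapT => ne.
have FF : ProperFilter (filter_from D B).
  apply: filter_from_proper; first exact: filter_from_filter.
  move=> i Di; apply/set0P; apply/negP => /eqP Bi0; apply: ne; by exists i.
have [|x [_ clx]] := cX _ FF; first by case: D0 => i Di; exists i.
have [i Di nBx] := sep x; apply: nBx; apply: (cB i Di) => A nA.
by apply: clx nA; exists i.
Qed.

Record spectrum (R : realType) (A : commCStarType R) := Spec {
  char_of :> A -> R[i];
  char_ofP : is_character char_of }.

Section Spectrum.
Variables (R : realType) (A : commCStarType R).
Local Notation X := (spectrum A).

Lemma spec_eq (f g : X) : f =1 g -> f = g.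
Proof.
case: f g => [f cf] [g cg] /= /funext fg; subst g.
by congr Spec; exact: Prop_irrelevance.
Qed.

HB.instance Definition _ := gen_eqMixin X.
HB.instance Definition _ := gen_choiceMixin X.

(** The weak-* topology, that of pointwise convergence. *)
Definition spec_subbase : set (set X) :=
  [set B | exists (a : A) (U : set R[i]), open U /\ B = [set f : X | U (f a)]].

HB.instance Definition _ := isSubBaseTopological.Build X spec_subbase id.

Lemma spec_eval_continuous (a : A) : continuous (fun f : X => f a).
Proof.
apply/continuousP => U oU.
exists [set (fun f : X => f a) @^-1` U]; last by rewrite bigcup_set1.
move=> _ ->; apply: (@finI_from1 _ _ spec_subbase id).
by exists a, U.
Qed.

Lemma cvg_spec (F : set_system X) (f : X) : Filter F ->
  (forall a : A, (fun g : X => g a) @ F --> f a) -> F --> f.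
Proof.
move=> FF h B; rewrite nbhsE => -[V [[D sD <-] [E DE Ef]] VB].
apply: filterS VB _; apply: (@filterS _ F _ E); first by move=> g Eg; exists E.
have [G sG EG] := sD _ DE; rewrite -EG in Ef *.
apply: filter_bigI => C CG; have := Ef C CG.
have /sG := CG; rewrite inE => -[a [U [oU ->]]] /= Ufa.
by apply: h; apply: open_nbhs_nbhs.
Qed.

Lemma continuous_spec (T : topologicalType) (p : T -> X) :
  (forall a : A, continuous (fun t => p t a)) -> continuous p.
Proof. by move=> h t; apply: cvg_spec => a; exact: h. Qed.

Lemma spec_hausdorff : hausdorff_space X.
Proof.
move=> f g fg; apply: spec_eq => a; apply: (@norm_hausdorff _ R[i]) => U V Uf Vg.
have [h [Uh Vh]] := fg _ _ (spec_eval_continuous Uf) (spec_eval_continuous Vg).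
by exists (h a).
Qed.

(** Banach-Alaoglu by ultrafilters: at each [a] the values stay in the disc of radius [nm a] by
    [char_le], so they converge, and the conditions on a character pass to the pointwise limit. *)
Lemma spec_compact : compact [set: X].
Proof.
rewrite compact_ultra => F FU _.
have /choice[l lP] : forall a : A, exists z : R[i], (fun g : X => g a) @ F --> z.
  move=> a; have FF : ProperFilter ((fun g : X => g a) @ F) by exact: fmap_proper_filter.
  have [|z [_ clz]] := @complex_closed_ball_compact R (nm (a : cstar_ring A)) _ FF.
    suff : F [set g : X | `|g a| <= (nm (a : cstar_ring A))%:C] by [].
    by apply: filterE => g; have := char_le (char_ofP g) a; rewrite [X in _ <= X]nmE.
  (* An ultrafilter contains each set or its complement, so a cluster point is a limit. *)
  exists z => W nW; have [//|nF] := in_ultra_setVsetC ((fun g : X => g a) @^-1` W) FU.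
  by have [w []] := clz (~` W) W nF nW.
have uniq (u : X -> R[i]) (z w : R[i]) : u @ F --> z -> u @ F --> w -> z = w.
  move=> h1 h2; have UF : ProperFilter (u @ F) by exact: fmap_proper_filter.
  exact: (@cvg_unique _ (@norm_hausdorff _ R[i]) _ UF z w h1 h2).
have cl : is_character l.
  split.
  - move=> c a b; apply: (uniq _ _ _ (lP (c *: a + b))).
    rewrite (_ : (fun g : X => g _) = fun g : X => c * g a + g b); last first.
      by apply/funext => g; rewrite (charD (char_ofP g)) (charZ (char_ofP g)).
    by apply: cvgD; [apply: cvgM; [exact: cvg_cst|exact: lP]|exact: lP].
  - apply: (uniq _ _ _ (lP cone)).
    rewrite (_ : (fun g : X => g _) = fun=> 1); first exact: cvg_cst.
    by apply/funext => g; exact: char1 (char_ofP g).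
  - move=> a b; apply: (uniq _ _ _ (lP (cmul a b))).
    rewrite (_ : (fun g : X => g _) = fun g : X => g a * g b); last first.
      by apply/funext => g; rewrite (charM (char_ofP g)).
    by apply: cvgM; exact: lP.
  - move=> a; apply: (uniq _ _ _ (lP (star a))).
    rewrite (_ : (fun g : X => g _) = fun g : X => (g a)^*); last first.
      by apply/funext => g; rewrite (char_star (char_ofP g)).
    have cJ : continuous (fun z : R[i] => z^*) by apply: continuousCJ => z; exact: cvg_id.
    by apply: (continuous_cvg _ (cJ (l a))); exact: lP.
exists (Spec cl); split => //; apply: cvg_spec; exact: lP.
Qed.

End Spectrum.

(** * The Gelfand transform *)

Section Gelfand.
Variables (R : realType) (A : commCStarType R).
Local Notation B := (cstar_ring A).
Local Notation X := (spectrum A).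
Local Notation rl := (real_of A).
Implicit Types (a b : B) (x y : X) (e r : R).

Definition value a x : R := complex.Re (x a).

Lemma value_continuous a : continuous (value a).
Proof. by apply: continuous_Re; exact: spec_eval_continuous. Qed.

Lemma value_SA a x : SA a -> x a = (value a x)%:C.
Proof. by move=> /(char_SA (char_ofP x)); rewrite /value; case: (x a) => u v /= ->. Qed.

Lemma valueD a b x : value (a + b) x = value a x + value b x.
Proof. by rewrite /value (charD (char_ofP x)) raddfD. Qed.
Lemma valueN a x : value (- a) x = - value a x.
Proof. by rewrite /value (charN (char_ofP x)) raddfN. Qed.
Lemma value_real r x : value (rl r) x = r.
Proof. by rewrite /value (char_real (char_ofP x)). Qed.
Lemma valueM a b x : SA a -> SA b -> value (a * b) x = value a x * value b x.
Proof.
move=> sa sb; rewrite {1}/value -[a * b]/(cmul (a : A) b) (charM (char_ofP x)).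
by rewrite (value_SA x sa) (value_SA x sb) /= mul0r subr0.
Qed.
Lemma value_scale r a x : SA a -> value (rl r * a) x = r * value a x.
Proof. by move=> sa; rewrite valueM ?value_real //; exact: SAr. Qed.
Lemma value_Pos a x : Pos a -> 0 <= value a x.
Proof. by move=> /(char_Pos (char_ofP x)); rewrite lecE => /andP[]. Qed.

Lemma nm_le_spec a M : 0 <= M -> (forall x, `|x a| <= M%:C) -> nm a <= M.
Proof.
move=> M0 h; rewrite leNgt; apply/negP => Ma.
have [|f cf hf] := @character_large _ _ a ((M + nm a) / 2).
  by apply/andP; split; lra.
have := le_trans hf (h (Spec cf)); rewrite lecR; lra.
Qed.

Lemma gelfand_inj (a b : A) : (forall x, x a = x b) -> a = b.
Proof.
move=> h; apply/eqP; rewrite -subr_eq0; apply/eqP/(@nm0_eq0 R A)/eqP.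
rewrite eq_le nm_ge0 andbT; apply: nm_le_spec => // x.
by rewrite [x _](charB (char_ofP x)) h subrr normr0.
Qed.

Lemma spec_separates x y : x <> y -> exists2 a, SA a & value a x != value a y.
Proof.
move=> xy; apply: contrapT => h; apply: xy; apply: spec_eq => a.
have eqv b : SA b -> value b x = value b y.
  by move=> sb; apply/eqP; apply: contrapT => /negP ne; apply: h; exists b.
rewrite [a](@re_im R A) [LHS](charD (char_ofP x)) [RHS](charD (char_ofP y)).
have im (z : X) : z (scalar_of A 'i * im_part a) = 'i * z (im_part a).
  rewrite [LHS](charM (char_ofP z)) /scalar_of (charZ (char_ofP z)).
  by rewrite (char1 (char_ofP z)) mulr1.
have [sr si] := (re_part_SA a, im_part_SA a).
by rewrite !im !(value_SA _ sr) !(value_SA _ si) !eqv.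
Qed.

(** The maximum of u and v is half of u + v + |u - v|; here |u - v| is replaced by the square root
    of [(a - b) ^+ 2 + d ^+ 2], which exceeds it by at most [d]. *)
Lemma approx_max a b d : SA a -> SA b -> 0 < d -> exists2 c, SA c & forall x,
  [/\ value a x <= value c x, value b x <= value c x &
      value c x <= Num.max (value a x) (value b x) + d].
Proof.
move=> sa sb d0; have sab : SA (a - b) by exact: SAB.
have d2 : 0 < d ^+ 2 by rewrite exprn_gt0.
have [s [ss Ps s2]] := Pos_sqrt (Pos_sqr sab) d2.
have sS : SA (a + b + s) by apply: SAD => //; exact: SAD.
exists (rl 2^-1 * (a + b + s)); first by apply: SAM => //; exact: SAr.
move=> x; rewrite value_scale // !valueD.
have s0 := value_Pos x Ps.
have : value (s ^+ 2) x = (value a x - value b x) ^+ 2 + d ^+ 2.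
  rewrite s2 valueD value_real; congr (_ + _).
  by rewrite expr2 valueM // valueD valueN expr2.
rewrite expr2 valueM // => es.
set u := value a x in es *; set v := value b x in es *; set w := value s x in s0 es *.
have wl : u - v <= w /\ v - u <= w by split; nra.
case: wl => w1 w2.
have wu : w <= `|u - v| + d.
  by have := normr_ge0 (u - v); rewrite -real_normK ?num_real // in es; nra.
split; [lra|lra|].
case: (leP u v) wu => uv; [rewrite ler0_norm ?subr_le0 //|rewrite gtr0_norm ?subr_gt0 //]; lra.
Qed.

Lemma approx_min a b d : SA a -> SA b -> 0 < d -> exists2 c, SA c & forall x,
  [/\ value c x <= value a x, value c x <= value b x &
      Num.min (value a x) (value b x) - d <= value c x].
Proof.
move=> sa sb d0; have [c sc h] := approx_max (SAN sa) (SAN sb) d0.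
exists (- c); first exact: SAN.
move=> x; have [] := h x; rewrite !valueN.
case: (leP (- value a x) (- value b x)); case: (leP (value a x) (value b x));
  by move=> *; split; lra.
Qed.

Lemma interpolate (f : X -> R) x y : exists a, [/\ SA a, value a x = f x & value a y = f y].
Proof.
have [<-|/spec_separates[b sb bxy]] := pselect (x = y).
  by exists (rl (f x)); split; [exact: SAr|exact: value_real|exact: value_real].
have bxy0 : value b x - value b y != 0 by rewrite subr_eq0.
pose k := (f x - f y) / (value b x - value b y).
have sk : SA (rl k * b) by apply: SAM => //; exact: SAr.
exists (rl k * b + rl (f x - k * value b x)); split.
- by apply: SAD => //; exact: SAr.
- by rewrite valueD value_real value_scale // subrKC.
- rewrite valueD value_real value_scale // /k; field.
  by rewrite bxy0.
Qed.

(** Among the elements below [f + e] at [x], [C a] is the set where [a] is still too small.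
    Approximate maxima make these sets directed and two-point interpolation makes every point escape
    one of them, so one of them is empty. *)
Lemma stone_weierstrass_upper (f : X -> R) x e : continuous f -> 0 < e ->
  exists a, [/\ SA a, value a x < f x + e & forall y, f y - e < value a y].
Proof.
move=> cf e0.
pose D := [set a : B | SA a /\ value a x < f x + e].
pose C a := [set y | value a y <= f y - e].
have [||||a [sa ax] Ca0] := @compact_directed X B D C (@spec_compact R A).
- by exists (rl (f x)); split; [exact: SAr|rewrite value_real ltrDl].
- move=> a _; rewrite (_ : C a = (fun y => value a y - f y) @^-1` [set r | r <= - e]).
    apply: preimage_closed; last exact: closed_le.
    by move=> y _; exact: (cvgB (@value_continuous a y) (cf y)).
  by apply/funext => y; rewrite /C /preimage /mkset; congr is_true; lra.
- move=> a b [sa ax] [sb bx].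
  (* Half of the room left at [x], so that [c] stays below [f x + e] there. *)
  have [|c sc h] := @approx_max a b ((f x + e - Num.max (value a x) (value b x)) / 2) sa sb.
    by rewrite divr_gt0 // subr_gt0 gt_max ax bx.
  exists c.
    split=> //; have [_ _] := h x.
    have : Num.max (value a x) (value b x) < f x + e by rewrite gt_max ax bx.
    lra.
  by move=> y; rewrite /C /= => cy; have [h1 h2 _] := h y; split; lra.
- move=> y; have [a [sa ax ay]] := interpolate f x y.
  exists a; first by split => //; rewrite ax ltrDl.
  by rewrite /C /= ay => ?; lra.
- exists a; split => // y; rewrite ltNge; apply/negP => ya.
  by have : C a y by []; rewrite Ca0.
Qed.

Lemma stone_weierstrass (f : X -> R) e : continuous f -> 0 < e ->
  exists2 a, SA a & forall y, `|value a y - f y| < e.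
Proof.
move=> cf e0.
(* The margin [d < e] is uniform in [y], because [approx_min] loses a fixed amount everywhere; each
   combination spends half of what remains. *)
pose D := [set a : B | SA a /\ exists2 d, d < e & forall y, f y - d < value a y].
pose C a := [set y | f y + e <= value a y].
have e2 : 0 < e / 2 by rewrite divr_gt0.
(* Any point of the spectrum yields a member of [D], so if [D] is empty then so is the spectrum. *)
have [D0|D0] := pselect (D !=set0); last first.
  have noX (y : X) : False.
    have [a [sa _ h]] := stone_weierstrass_upper y cf e2.
    by apply: D0; exists a; split => //; exists (e / 2) => //; lra.
  by exists 0; [exact: SA0|move=> y; case: (noX y)].
have [|||a [sa [d de ad]] Ca0] := @compact_directed X B D C (@spec_compact R A) D0.
- move=> a _; rewrite (_ : C a = (fun y => value a y - f y) @^-1` [set r | e <= r]).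
    apply: preimage_closed; last exact: closed_ge.
    by move=> y _; exact: (cvgB (@value_continuous a y) (cf y)).
  by apply/funext => y; rewrite /C /preimage /mkset; congr is_true; lra.
- move=> a b [sa [d de ad]] [sb [d' de' bd]].
  have md : Num.max d d' < e by rewrite gt_max de de'.
  have [|c sc h] := @approx_min a b ((e - Num.max d d') / 2) sa sb; first by lra.
  exists c.
    split=> //; exists ((e + Num.max d d') / 2); first by lra.
    move=> y; have [_ _] := h y; have := ad y; have := bd y.
    have [m1 m2] : d <= Num.max d d' /\ d' <= Num.max d d' by rewrite !le_max !lexx orbT.
    by case: (leP (value a y) (value b y)); lra.
  by move=> y; rewrite /C /= => cy; have [h1 h2 _] := h y; split; lra.
- move=> y; have [a [sa ay ah]] := stone_weierstrass_upper y cf e2.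
  exists a; first by split => //; exists (e / 2) => //; lra.
  by rewrite /C /= => ?; lra.
- exists a => // y; rewrite ltr_norml; apply/andP; split; first by have := ad y; lra.
  rewrite ltrBlDl ltNge; apply/negP => ya.
  by have : C a y by []; rewrite Ca0.
Qed.

Lemma gelfand_surj_real (f : X -> R) : continuous f ->
  exists a : A, forall x, x a = (f x)%:C.
Proof.
move=> cf; have h2 : 0 <= (2^-1 : R) < 1 by lra.
have /choice[u uP] : forall n, exists a, SA a /\ forall y, `|value a y - f y| < 2^-1 ^+ n.
  move=> n; have [|a sa h] := stone_weierstrass (e := 2^-1 ^+ n) cf.
    by rewrite exprn_gt0 // invr_gt0.
  by exists a.
have su n : SA (u n) by case: (uP n).
have close n x : `|value (u n) x - f x| < 2^-1 ^+ n by case: (uP n).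
have [l lP] : exists l : B, forall e, 0 < e ->
    exists n0, forall n, (n0 <= n)%N -> nm (l - u n) < e.
  (* Uniform closeness of the values is closeness in norm by [nm_le_spec], so the approximants
     converge in the algebra. *)
  apply: cauchy_nm_cvg => e e0; have e4 : 0 < e / 4 by rewrite divr_gt0.
  have [n0 hn] := expr_small h2 e4; exists n0 => m n n0m n0n.
  apply: (@le_lt_trans _ _ (e / 2)); last by lra.
  apply: nm_le_spec => [|x]; first by lra.
  have sm : SA (u m - u n) by apply: SAB.
  rewrite (value_SA x sm) normc_real lecR valueD valueN.
  have := close m x; have := close n x; have := hn _ n0m; have := hn _ n0n.
  rewrite !ltr_norml ler_norml => h1 h3 /andP[h4 h5] /andP[h6 h7].
  by apply/andP; split; lra.
have sl : SA l by apply: (SA_lim su) => e /lP[n hn]; exists n; exact: hn.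
exists l => x; rewrite (value_SA x sl); congr (_%:C); apply/eqP; rewrite -subr_eq0 -normr_eq0.
rewrite eq_le normr_ge0 andbT; apply/ler_addgt0Pr => e e0; rewrite add0r.
have e2 : 0 < e / 2 by rewrite divr_gt0.
have [n0 hn] := lP _ e2; have [n1 hn'] := expr_small h2 e2.
have n0m := leq_maxl n0 n1; have n1m := leq_maxr n0 n1; set n := maxn n0 n1 in n0m n1m *.
have : `|value (l - u n) x| <= nm (l - u n).
  have := char_le (char_ofP x) (l - u n).
  by rewrite (value_SA x (SAB sl (su n))) normc_real [X in _ <= X]nmE lecR.
have := hn _ n0m; have := hn' _ n1m; have := close n x.
rewrite valueD valueN ltr_norml !ler_norml => /andP[? ?] ? ? /andP[? ?].
by apply/andP; split; lra.
Qed.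

Lemma gelfand_surj (f : X -> R[i]) : continuous f -> exists a : A, forall x, x a = f x.
Proof.
move=> cf; have [a ha] := gelfand_surj_real (continuous_Re cf).
have [b hb] := gelfand_surj_real (continuous_Im cf).
exists (a + 'i *: b) => x.
by rewrite (charD (char_ofP x)) (charZ (char_ofP x)) ha hb -complexE.
Qed.

End Gelfand.

(** * The space P^(N-1)(Z/2) and the stratification of a covered space *)

Section ProjectiveSpace.
Variable N : nat.
Local Notation P := (projective_space N).
Implicit Types z w : P.

Definition coord z i := (sval z : 'rV['F_2]_N) ord0 i != 0.

Lemma open_chart i : open (@chart N i).
Proof.
exists [set @chart N i]; last by rewrite bigcup_set1.
by move=> _ ->; apply: (@finI_from1 _ _ (range (@chart N)) id); exists i.
Qed.

Lemma open_upward (U : set P) z w : open U -> U z ->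
  (forall i, coord z i -> coord w i) -> U w.
Proof.
move=> [D sD <-] [E DE Ez] zw; exists E => //.
have [G sG EG] := sD _ DE; rewrite -EG in Ez *.
move=> C CG; have := Ez C CG; have /sG := CG; rewrite inE => -[i _ <-] /=.
exact: zw.
Qed.

(** The smallest open set containing [z], by [open_star_nbhs] and [open_upward]. *)
Definition star_nbhs z : set P := [set w | forall i, coord z i -> coord w i].

Lemma open_star_nbhs z : open (star_nbhs z).
Proof.
have -> : star_nbhs z = \big[setI/setT]_(i <- enum 'I_N | coord z i) @chart N i.
  rewrite -bigcap_seq_cond; apply/seteqP; split => w zw i.
    by move=> /= /andP[_]; exact: zw.
  by move=> zi; apply: zw; rewrite /= mem_enum.
by apply: big_ind => [||i _]; [exact: openT|exact: openI|exact: open_chart].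
Qed.

End ProjectiveSpace.

(** * Boundedness, Urysohn and Tietze for complex functions *)

Section CompactHausdorff.
Variables (R : realType) (T : topologicalType).
Hypotheses (cT : compact [set: T]) (hT : hausdorff_space T).

Lemma compact_within_bounded (S : set T) (f : T -> R[i]) : closed S ->
  {within S, continuous f} -> (forall x, ~ S x -> f x = 0) ->
  exists M : R, forall x, `|f x| <= M%:C.
Proof.
move=> cS cf f0; have [S0|nS] := pselect (S !=set0); last first.
  by exists 0 => x; rewrite f0 ?normr0 // => Sx; apply: nS; exists x.
have KS : compact S by apply: subclosed_compact cT _.
have [|c _ hc] := @compact_EVT_max T R (fun x => complex.Re `|f x|) S S0 KS.
  move=> x; apply: (@continuous_Re R (subspace S) (fun x => `|f x|)) => y.
  apply: (@continuous_comp (subspace S) R[i] R[i] f (fun z => `|z|)); first exact: cf.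
  exact: norm_continuous.
exists (complex.Re `|f c|) => x.
have [Sx|/f0 ->] := pselect (S x); last by rewrite normr0 Re_norm.
by rewrite -[leLHS]Re_norm lecR hc ?inE.
Qed.

Lemma complex_urysohn (S : set T) x : closed S -> ~ S x ->
  exists f : T -> R[i], [/\ continuous f, forall y, S y -> f y = 0 & f x = 1].
Proof.
move=> cS Sx; have nT := compact_normal hT cT.
have [f [cf f0 f1 _]] : exists f : T -> R, [/\ continuous f,
    f @` S `<=` [set 0], f @` [set x] `<=` [set 1] & range f `<=` `[0, 1]].
  apply: urysohn_ext_itv => //.
    exact: (accessible_closed_set1 (hausdorff_accessible hT)).
  by apply/seteqP; split => // y [Sy /= yx]; apply: Sx; rewrite -yx.
exists (fun y => f y +i* 0); split.
- by apply: continuous_complex => // y; exact: cvg_cst.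
- by move=> y Sy; have -> : f y = 0 by apply: f0; exists y.
- by have -> : f x = 1 by apply: f1; exists x.
Qed.

Lemma complex_tietze (S : set T) (f : T -> R[i]) : closed S ->
  {within S, continuous f} -> (exists M : R, forall x, `|f x| <= M%:C) ->
  exists2 g : T -> R[i], continuous g & forall x, S x -> g x = f x.
Proof.
move=> cS cf [M fM]; have nT := compact_normal hT cT.
have M1 : 0 < `|M| + 1 by rewrite ltr_wpDl.
have bd x : `|f x| <= (`|M| + 1)%:C.
  by apply: le_trans (fM x) _; rewrite lecR; have := ler_norm M; lra.
have [||u [uf cu _]] := @continuous_bounded_extension T R nT S cS
    (fun x => complex.Re (f x)) _ M1.
- exact: (@continuous_Re R (subspace S) f).
- by move=> x _; rewrite -lecR; apply: le_trans (normc_Re _) (bd x).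
have [||v [vf cv _]] := @continuous_bounded_extension T R nT S cS
    (fun x => complex.Im (f x)) _ M1.
- exact: (@continuous_Im R (subspace S) f).
- by move=> x _; rewrite -lecR; apply: le_trans (normc_Im _) (bd x).
exists (fun x => u x +i* v x); first exact: continuous_complex.
by move=> x Sx; rewrite -uf ?inE // -vf ?inE //; case: (f x).
Qed.

End CompactHausdorff.

Lemma within_finite_closed_cover (T U : topologicalType) (I : choiceType) (D : set I)
  (C : I -> set T) (f : T -> U) : finite_set D ->
  (forall i, D i -> closed (C i)) -> (forall i, D i -> {within C i, continuous f}) ->
  {within \bigcup_(i in D) C i, continuous f}.
Proof.
move=> /finite_seqP[s ->]; rewrite bigcup_seq; elim: s => [|i s ih] cC cf.
  by rewrite big_nil; exact: continuous_subspace0.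
rewrite big_cons; apply: withinU_continuous; [by apply: cC; exact: mem_head| | |].
- by apply: closed_bigsetU => j js; apply: cC; rewrite /= inE js orbT.
- by apply: cf; exact: mem_head.
- by apply: ih => j js; [apply: cC|apply: cf]; rewrite /= inE js orbT.
Qed.

Lemma within_comp (T U V : topologicalType) (S : set T) (S' : set U)
  (f : T -> U) (g : U -> V) : continuous f -> (forall x, S x -> S' (f x)) ->
  {within S', continuous g} -> {within S, continuous (g \o f)}.
Proof.
move=> cf fS /subspace_continuousP cg; apply/subspace_continuousP => x Sx W /=.
move=> /(cg _ (fS _ Sx)) nW.
have : \forall y \near x, S' (f y) -> W (g (f y)) by exact: (cf x) nW.
by apply: filterS => y h Sy; apply: h; exact: fS.
Qed.

Section Strata.
Variables (N : nat) (X : covered_space N).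
Local Notation P := (projective_space N).

Definition sigma_row (x : X) : 'rV['F_2]_N := \row_i (if `[< piece X i x >] then 1 else 0).

Lemma sigma_row_neq0 x : sigma_row x != 0.
Proof.
have : [set: X] x by []; rewrite -piece_cover => -[i _ Xix].
apply/eqP => /rowP/(_ i); rewrite !mxE asboolT // => /eqP.
Qed.

Definition sigma (x : X) : P :=
  exist (fun z : 'rV['F_2]_N => is_true (z != 0)) (sigma_row x) (sigma_row_neq0 x).

Lemma coord_sigma x i : coord (sigma x) i <-> piece X i x.
Proof.
rewrite /coord /= mxE; case: asboolP => h; first by rewrite oner_eq0.
by rewrite eqxx; split.
Qed.

(* By [regionE], this is also the union over [z] in [U] of the intersections
   of the pieces indexed by the support of [z]. *)
Definition region (U : opens P) : set X := [set x | oset U (sigma x)].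

(** The preimage of [star_nbhs z] under [sigma]. *)
Definition stratum (z : P) : set X := [set x | forall i, coord z i -> piece X i x].

Lemma closed_stratum z : closed (stratum z).
Proof.
have -> : stratum z = \bigcap_(i in [set i | coord z i]) piece X i by [].
by apply: closed_bigI => i _; exact: piece_closed.
Qed.

Lemma regionE U : region U = \bigcup_(z in oset U) stratum z.
Proof.
apply/seteqP; split => [x Ux|x [z Uz zx]].
  by exists (sigma x) => // i /coord_sigma.
apply: open_upward (osetP U) Uz _ => i /zx Xi; exact/coord_sigma.
Qed.

Lemma finite_projective (U : set P) : finite_set U.
Proof.
apply: (sub_finite_set (@subsetT _ U)).
apply: (@finite_preimage P 'rV['F_2]_N [set: _] sval); last exact: finite_finset.
by move=> z w _ _; exact: val_inj.
Qed.

(** Each stratum is closed and the projective space is finite, so [regionE] presents the region as a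
    finite union of closed sets. *)
Lemma closed_region U : closed (region U).
Proof.
rewrite regionE; apply: closed_bigcup => [|z _]; first exact: finite_projective.
exact: closed_stratum.
Qed.

Lemma stratum_sub_region U z : oset U z -> stratum z `<=` region U.
Proof. by move=> Uz x zx; rewrite regionE; exists z. Qed.

End Strata.

(** * From covered spaces to flabby sheaves *)

Section Restriction.
Variables (R : realType) (T : topologicalType).
Implicit Types S : set T.

Section Pullback.
Variables (U : topologicalType) (S : set T) (S' : set U) (p : T -> U).
Hypotheses (cp : continuous p) (pS : forall x, S x -> S' (p x)).

Fact bcpull_continuous (f : bcfun R S') : {within S, continuous (indic_fun S (f \o p))}.
Proof. by apply: indic_fun_continuous; apply: within_comp (@bc_continuous _ _ _ f). Qed.
Fact bcpull_bounded (f : bcfun R S') : exists M : R, forall x, `|indic_fun S (f \o p) x| <= M%:C.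
Proof.
have [M h] := bc_bounded f; exists `|M| => x; rewrite /indic_fun; case: asboolP => _.
  by apply: le_trans (h _) _; rewrite lecR ler_norm.
by rewrite normr0 ler0c.
Qed.

Definition bcpull (f : bcfun R S') : bcfun R S :=
  BCFun (@bcpull_continuous f) (@indic_funF _ _ S (f \o p)) (bcpull_bounded f).

Lemma bcpullE f x : S x -> bcpull f x = f (p x).
Proof. exact: indic_funT. Qed.

Lemma bcpull_linear : linear bcpull.
Proof.
move=> c f g; apply: bcfun_eq => x; rewrite /= /indic_fun /=.
by case: asboolP => _ //; rewrite mulr0 addr0.
Qed.
Lemma bcpull1 : bcpull cone = cone.
Proof.
apply: bcfun_eq => x; rewrite /= /indic_fun /= /indic_fun.
by case: asboolP => // /pS Sx; rewrite asboolT.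
Qed.
Lemma bcpullM : {morph bcpull : f g / cmul f g}.
Proof.
move=> f g; apply: bcfun_eq => x; rewrite /= /indic_fun /=.
by case: asboolP => _ //; rewrite mulr0.
Qed.
Lemma bcpull_star : {morph bcpull : f / star f}.
Proof.
move=> f; apply: bcfun_eq => x; rewrite /= /indic_fun /=.
by case: asboolP => _ //; rewrite conjc0.
Qed.

Definition bcpull_hom : star_hom (bcfun R S') (bcfun R S) :=
  StarHom bcpull_linear bcpull1 bcpullM bcpull_star.

End Pullback.

Definition bcres (S S' : set T) (SS : S `<=` S') : star_hom (bcfun R S') (bcfun R S) :=
  @bcpull_hom T S S' id (fun x => @cvg_id T (nbhs x)) SS.

Lemma bcresE (S S' : set T) (SS : S `<=` S') (f : bcfun R S') x : S x -> bcres SS f x = f x.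
Proof. exact: indic_funT. Qed.

Lemma bcfun_eq_on S (f g : bcfun R S) : (forall x, S x -> f x = g x) -> f = g.
Proof.
move=> h; apply: bcfun_eq => x; have [/h//|Sx] := pselect (S x).
by rewrite !bc_off.
Qed.

End Restriction.

Section FunctionSheaf.
Variables (R : realType) (N : nat) (X : covered_space N).
Local Notation P := (projective_space N).
Implicit Types U V W : opens P.

Let cX := @cspace_compact N X.

Lemma region_sub U V : V `<=` U -> @region N X V `<=` @region N X U.
Proof. by move=> VU x; exact: VU. Qed.

Lemma bcfun_of (S : set X) (f : X -> R[i]) : closed S -> {within S, continuous f} ->
  exists g : bcfun R S, forall x, S x -> g x = f x.
Proof.
move=> cS cf; have bd := @compact_within_bounded R X cX S (indic_fun S f) cS
  (indic_fun_continuous cf) (@indic_funF R X S f).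
by exists (BCFun (indic_fun_continuous cf) (@indic_funF R X S f) bd) => x Sx; exact: indic_funT.
Qed.

Definition funsheaf_res U V (VU : V `<=` U) :
  star_hom (bcfun R (@region N X U)) (bcfun R (@region N X V)) :=
  bcres R (region_sub VU).

Lemma funsheaf_resE U V (VU : V `<=` U) f x :
  @region N X V x -> funsheaf_res VU f x = f x.
Proof. exact: bcresE. Qed.

Lemma funsheaf_res_id U (UU : U `<=` U) f : funsheaf_res UU f = f.
Proof. by apply: bcfun_eq_on => x Ux; rewrite funsheaf_resE. Qed.

Lemma funsheaf_res_comp U V W (VU : V `<=` U) (WV : W `<=` V) (WU : W `<=` U) f :
  funsheaf_res WV (funsheaf_res VU f) = funsheaf_res WU f.
Proof.
apply: bcfun_eq_on => x Wx; rewrite !funsheaf_resE //; exact: (region_sub WV).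
Qed.

Lemma funsheaf_locality U (I : Type) (V : I -> opens P)
    (VU : forall i, V i `<=` U) : \bigcup_i V i = U ->
  forall f g, (forall i, funsheaf_res (VU i) f = funsheaf_res (VU i) g) -> f = g.
Proof.
move=> VE f g fg; apply: bcfun_eq_on => x Ux.
have : (\bigcup_i V i) (sigma x) by rewrite VE.
move=> [i _ Vx]; have := congr1 (fun h : bcfun R _ => h x) (fg i).
by rewrite !funsheaf_resE.
Qed.

(** The regions of the [V i] are closed and possibly infinitely many, so continuity of the glued
    function is checked on the finite closed cover by strata: for [z] in [V i] the whole stratum of
    [z] lies in the region of [V i]. *)
Lemma funsheaf_gluing U (I : Type) (V : I -> opens P)
    (VU : forall i, V i `<=` U) : \bigcup_i V i = U ->
  forall f : forall i, bcfun R (@region N X (V i)),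
  (forall i j,
     funsheaf_res (V := opensI (V i) (V j)) (@subIsetl _ (V i) (V j)) (f i) =
     funsheaf_res (V := opensI (V i) (V j)) (@subIsetr _ (V i) (V j)) (f j)) ->
  exists g, forall i, funsheaf_res (VU i) g = f i.
Proof.
move=> VE f ff.
have agree i j x : @region N X (V i) x -> @region N X (V j) x -> f i x = f j x.
  move=> ix jx; have := congr1 (fun h : bcfun R _ => h x) (ff i j).
  by rewrite !funsheaf_resE.
have /choice[u uP] : forall x, exists z, forall i, @region N X (V i) x -> f i x = z.
  move=> x; have [[i ix]|h] := pselect (exists i, @region N X (V i) x).
    by exists (f i x) => j jx; exact: agree.
  by exists 0 => i ix; exfalso; apply: h; exists i.
have [|g gu] := @bcfun_of (@region N X U) u (@closed_region N X U).
  rewrite regionE; apply: within_finite_closed_cover.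
  - exact: finite_projective.
  - by move=> z _; exact: closed_stratum.
  move=> z; rewrite -VE => -[i _ zi].
  apply: (@subspace_eq_continuous _ _ _ (f i)).
    by move=> x; rewrite inE => /(stratum_sub_region zi)/uP.
  apply: (continuous_subspaceW (stratum_sub_region zi)).
  exact: (@bc_continuous _ _ _ (f i)).
exists g => i; apply: bcfun_eq_on => x ix.
by rewrite funsheaf_resE // gu ?uP //; exact: (region_sub (VU i)).
Qed.

Definition funsheaf : sheaf R P :=
  Sheaf funsheaf_res_id funsheaf_res_comp funsheaf_locality funsheaf_gluing.

Lemma funsheaf_extension U (f : bcfun R (@region N X U)) :
  exists2 g : X -> R[i], continuous g & forall x, @region N X U x -> g x = f x.
Proof.
by apply: (complex_tietze cX (@cspace_hausdorff N X)); [exact: closed_region|exact: bc_continuous|exact: bc_bounded].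
Qed.

Lemma funsheaf_flabby : flabby funsheaf.
Proof.
move=> U V VU f; have [g cg gf] := funsheaf_extension f.
have [h hg] := @bcfun_of (@region N X U) g (@closed_region N X U) (continuous_subspaceT cg).
exists h; apply: bcfun_eq_on => x Vx.
by rewrite [LHS]funsheaf_resE // hg ?gf //; exact: (region_sub VU).
Qed.

Definition funsheaf_obj : flabby_sheaf R P := FlabbySheaf funsheaf_flabby.

End FunctionSheaf.

Section FunctionSheafMap.
Variables (R : realType) (N : nat).
Implicit Types X Y Z : covered_space N.

(** A covered map can only enlarge the support of a point, and open sets are upward closed. *)
Lemma region_map X Y (f : covered_map X Y) U x :
  @region N X U x -> @region N Y U (f x).
Proof.
move=> Ux; apply: open_upward (osetP U) Ux _ => i /coord_sigma Xi.
by apply/coord_sigma; apply: (@cmap_piece _ _ _ f); exists x.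
Qed.

Definition funsheaf_map_at X Y (f : covered_map X Y) U :
    star_hom (funsheaf R Y U) (funsheaf R X U) :=
  @bcpull_hom R X Y (@region N X U) (@region N Y U) f (@cmap_continuous _ _ _ f)
    (@region_map X Y f U).

Lemma funsheaf_map_atE X Y (f : covered_map X Y) U g x :
  @region N X U x -> funsheaf_map_at f U g x = g (f x).
Proof. exact: bcpullE. Qed.

Lemma funsheaf_map_res X Y (f : covered_map X Y) (U V : opens (projective_space N))
    (VU : V `<=` U) g :
  funsheaf_map_at f V (res (funsheaf R Y) VU g) =
  res (funsheaf R X) VU (funsheaf_map_at f U g).
Proof.
apply: bcfun_eq_on => x Vx; rewrite [RHS]funsheaf_resE // funsheaf_map_atE //.
rewrite [LHS]funsheaf_resE ?funsheaf_map_atE //; first exact: (region_sub VU).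
exact: region_map.
Qed.

Definition funsheaf_map X Y (f : covered_map X Y) :
  sheaf_hom (funsheaf R Y) (funsheaf R X) := SheafHom (@funsheaf_map_res X Y f).

Lemma funsheaf_map1 X : funsheaf_map (covered_id X) = sheaf_id (funsheaf R X).
Proof.
by apply: sheaf_hom_eq => U g; apply: bcfun_eq_on => x Ux; rewrite [LHS]funsheaf_map_atE.
Qed.

Lemma funsheaf_mapM X Y Z (f : covered_map Y Z) (g : covered_map X Y) :
  funsheaf_map (covered_comp f g) = sheaf_comp (funsheaf_map g) (funsheaf_map f).
Proof.
apply: sheaf_hom_eq => U h; apply: bcfun_eq_on => x Ux.
rewrite [LHS]funsheaf_map_atE // [RHS]funsheaf_map_atE // [RHS]funsheaf_map_atE //.
exact: region_map.
Qed.

Definition functions_functor :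
    functor (opposite (covered_spaces N)) (flabby_sheaves R (projective_space N)) :=
  @Functor (opposite (covered_spaces N)) (flabby_sheaves R (projective_space N))
    (fun X : covered_space N => funsheaf_obj R X)
    (fun X Y f => @funsheaf_map Y X f)
    (fun X => @funsheaf_map1 X)
    (fun X Y Z f g => @funsheaf_mapM Z Y X g f).

End FunctionSheafMap.

(** * From flabby sheaves to covered spaces *)

Definition whole (T : topologicalType) : opens T := Opens (@openT T).

Section StarHomLemmas.
Variables (R : realType) (A B : commCStarType R) (h : star_hom A B).

Lemma star_hom0 : h 0 = 0.
Proof.
have := star_fun_linear h 1 0 0; rewrite !scale1r addr0 => /eqP.
by rewrite -subr_eq0 opprD addrA subrr sub0r oppr_eq0 => /eqP.
Qed.
Lemma star_homD a b : h (a + b) = h a + h b.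
Proof. by have := star_fun_linear h 1 a b; rewrite !scale1r. Qed.
Lemma star_homN a : h (- a) = - h a.
Proof. by apply/eqP; rewrite -addr_eq0 -star_homD addNr star_hom0. Qed.
Lemma star_homB a b : h (a - b) = h a - h b.
Proof. by rewrite star_homD star_homN. Qed.
Lemma cmul0 (a : A) : cmul 0 a = 0.
Proof. exact: (@mul0r (cstar_ring A)). Qed.

Lemma is_character_comp (f : spectrum B) : is_character (f \o h).
Proof.
split.
- by move=> c a b /=; rewrite (star_fun_linear h) (charD (char_ofP f)) (charZ (char_ofP f)).
- by rewrite /= star_fun1 (char1 (char_ofP f)).
- by move=> a b /=; rewrite star_funM (charM (char_ofP f)).
- by move=> a /=; rewrite star_fun_star (char_star (char_ofP f)).
Qed.

Definition spec_map (f : spectrum B) : spectrum A := Spec (is_character_comp f).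

Lemma spec_map_continuous : continuous spec_map.
Proof. by apply: continuous_spec => a; exact: (@spec_eval_continuous R B (h a)). Qed.

End StarHomLemmas.

(** * Restriction kernels and the pieces of the spectrum *)

Section SheafSpectrum.
Variables (R : realType) (N : nat) (P : flabby_sheaf R (projective_space N)).
Local Notation T := (projective_space N).
Local Notation A := (P (whole T)).
Local Notation rest U := (@res R T P (whole T) U (@subsetT T U)).
Implicit Types (U V W : opens T) (x : spectrum A).

(** Since [rest U] is onto, vanishing on its kernel is the same as factoring through [P U]. *)
Definition factors x U := forall s : A, rest U s = 0 -> x s = 0.

Lemma closed_factors U : closed [set x | factors x U].
Proof.
have -> : [set x | factors x U] =
  \bigcap_(s in [set s : A | rest U s = 0]) ((fun x => x s) @^-1` [set 0]).
  by apply/seteqP; split.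
apply: closed_bigI => s _; apply: preimage_closed.
  by move=> x _; exact: spec_eval_continuous.
exact: (accessible_closed_set1 (hausdorff_accessible (@norm_hausdorff _ R[i]))).
Qed.

Lemma rest_lift U (s : P U) : exists t : A, rest U t = s.
Proof. exact: fsheafP. Qed.

(** Locality for the empty cover. *)
Lemma sheaf_set0 U (s t : P U) : oset U = set0 -> s = t.
Proof.
move=> U0; have V (i : void) : opens T by case: i.
apply: (@sheaf_locality _ _ P U void V (fun i => match i with end)) => [|[]].
by rewrite U0; apply/seteqP; split => // z [[]].
Qed.

Lemma factors_set0 x U : oset U = set0 -> ~ factors x U.
Proof.
move=> U0 /(_ cone) h; have := h (sheaf_set0 _ _ U0); rewrite (char1 (char_ofP x)).
by apply/eqP; rewrite oner_eq0.
Qed.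

Lemma restK U V (VU : V `<=` U) (s : A) : res P VU (rest U s) = rest V s.
Proof. exact: res_comp. Qed.

Lemma rest_sub0 U V (s : A) : V `<=` U -> rest U s = 0 -> rest V s = 0.
Proof.
by move=> VU s0; rewrite -(restK VU) s0 star_hom0.
Qed.

Lemma factors_sub x U V : V `<=` U -> factors x V -> factors x U.
Proof. by move=> VU xV s s0; apply: xV; exact: rest_sub0 s0. Qed.

(* A product of an element vanishing on [U] and one vanishing on [V] vanishes
   on [U `|` V] by locality. *)
Lemma factors_setU x U V W : oset W `<=` oset U `|` oset V -> factors x W ->
  factors x U \/ factors x V.
Proof.
move=> WUV xW; apply: contrapT => /not_orP[/existsNP[s /not_implyP[s0 xs]]
  /existsNP[t /not_implyP[t0 xt]]].
have xst : x (cmul s t) = 0.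
  apply: xW.
  pose B (b : bool) : opens T := opensI W (if b then U else V).
  have BW b : B b `<=` W by move=> z [].
  apply: (@sheaf_locality _ _ P W bool B BW).
    apply/seteqP; split => [z [b _ /BW]//|z Wz].
    by case: (WUV z Wz) => h; [exists true|exists false].
  move=> b; rewrite star_hom0 restK star_funM.
  case: b.
    by rewrite (@rest_sub0 U (B true) s) ?cmul0 // => z [].
  by rewrite (@rest_sub0 V (B false) t) 1?cmulC ?cmul0 // => z [].
by move: xst; rewrite (charM (char_ofP x)) => /eqP; rewrite mulf_eq0 => /orP[] /eqP.
Qed.

(* If [s] vanishes on [U `&` V], then gluing [s] on [U] with [0] on [V] and
   extending by flabbiness yields [t] with [s - t] vanishing on [U] and [t]
   vanishing on [V]. *)
Lemma factors_setI x U V : factors x U -> factors x V -> factors x (opensI U V).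
Proof.
move=> xU xV s s0.
pose B (b : bool) : opens T := if b then U else V.
pose W : opens T := Opens (openU (osetP U) (osetP V)).
have BW b : B b `<=` W by case: b => z; [left|right].
have WE : \bigcup_b B b = W.
  apply/seteqP; split => [z [b _ /BW]//|z [Uz|Vz]]; [by exists true|by exists false].
pose f (b : bool) : P (B b) := if b return P (B b) then rest U s else 0.
(* The gluing condition runs over ordered pairs, and [opensI V U] is not the same term as
   [opensI U V]. *)
have VU0 : rest (opensI V U) s = 0 by apply: rest_sub0 s0 => z [].
have [|w wf] := @sheaf_gluing _ _ P W bool B BW WE f.
  by case; case; rewrite /f /= ?star_hom0 ?restK.
have [t tw] := rest_lift w.
have tU : rest U t = rest U s by have := wf true; rewrite /= -tw restK.
have tV : rest V t = 0 by have := wf false; rewrite /= -tw restK.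
rewrite -(subrK t s) (charD (char_ofP x)) (xV t tV) addr0; apply: xU.
by rewrite star_homB tU subrr.
Qed.

Lemma factors_whole x : factors x (whole T).
Proof. by move=> s; rewrite res_id => ->; exact: char0 (char_ofP x). Qed.

Definition chart_opens (i : 'I_N) : opens T := Opens (@open_chart N i).
Definition star_opens (z : T) : opens T := Opens (@open_star_nbhs N z).

(** The star of [z] is the finite intersection of the charts on the support of [z], so
    [factors_setI] is iterated along [enum 'I_N], starting from the whole space. *)
Lemma factors_star x z : factors x (star_opens z) <->
  forall i, coord z i -> factors x (chart_opens i).
Proof.
split=> [xz i zi|h]; first by apply: factors_sub xz => w; exact.
have [V [xV Vz]] : exists V : opens T, factors x V /\
    forall w, oset V w -> forall i, i \in enum 'I_N -> coord z i -> coord w i.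
  elim: (enum 'I_N) => [|i s [V [xV Vz]]].
    by exists (whole T); split=> //; exact: factors_whole.
  have [zi|zi] := boolP (coord z i).
    exists (opensI V (chart_opens i)); split; first by apply: factors_setI => //; exact: h.
    by move=> w [Vw wi] j; rewrite inE => /predU1P[->//|js]; exact: Vz.
  exists V; split=> // w Vw j; rewrite inE => /predU1P[->|js]; first by rewrite (negbTE zi).
  exact: Vz.
by apply: factors_sub xV => w /Vz Vw i; apply: Vw; rewrite mem_enum.
Qed.

(** [U] is the finite union of the stars of its points; [factors_setU] peels them off one at a time,
    and the empty union is excluded by [factors_set0]. *)
Lemma factors_point x U : factors x U -> exists2 z, oset U z & factors x (star_opens z).
Proof.
have /finite_seqP[s sU] := finite_projective (oset U).
have : oset U `<=` \bigcup_(z in [set` s]) star_nbhs z by rewrite sU => z sz; exists z.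
have sub : forall z, z \in s -> oset U z by move=> z zs; have : [set` s] z by []; rewrite -sU.
clear sU; elim: s U sub => [|z s ih] U sub cov xU.
  by exfalso; apply: (@factors_set0 x U) xU; apply/seteqP; split => // w /cov[y].
have oV : open (\bigcup_(w in [set` s]) star_nbhs w).
  by apply: bigcup_open => w _; exact: open_star_nbhs.
pose V := opensI U (Opens oV).
have [|xz|xV] := @factors_setU x (star_opens z) V U _ xU.
- move=> w Uw; have [y] := cov _ Uw; rewrite /= inE => /predU1P[->|ys] yw; first by left.
  by right; split => //; exists y.
- by exists z => //; apply: sub; exact: mem_head.
- have [|w [_ Vw]|y [Uy _] hy] := ih V _ _ xV.
  + move=> w ws; split; first by apply: sub; rewrite inE ws orbT.
    by exists w.
  + exact: Vw.
  + by exists y.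
Qed.

Definition gspec_piece (i : 'I_N) : set (spectrum A) := [set x | factors x (chart_opens i)].

Lemma gspec_cover : \bigcup_i gspec_piece i = [set: spectrum A].
Proof.
apply/seteqP; split => // x _; have [z _ /factors_star h] := factors_point (@factors_whole x).
have [i zi] : exists i, coord z i.
  apply: contrapT => n; have /negP := svalP z; apply; apply/eqP/rowP => i; rewrite mxE.
  by apply/eqP; apply: contrapT => /negP zi; apply: n; exists i.
by exists i => //; exact: h.
Qed.

Definition gspec : covered_space N :=
  @CoveredSpace N (spectrum A) gspec_piece (@spec_compact R A) (@spec_hausdorff R A)
    (fun i => @closed_factors (chart_opens i)) gspec_cover.

(** Reconciles the two descriptions of X_U: the left side sees only the pieces, that is, the charts,
    while the right side refers to [P U]. Stars mediate between them. *)
Lemma region_gspec U : @region N gspec U = [set x | factors x U].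
Proof.
apply/seteqP; split => [x Ux|x /= /factors_point[z Uz /factors_star xz]].
  have : factors x (star_opens (@sigma N gspec x)) by apply/factors_star => i /coord_sigma.
  apply: factors_sub => w xw; exact: open_upward (osetP U) Ux xw.
apply: open_upward (osetP U) Uz _ => i /xz xi; exact/(@coord_sigma N gspec).
Qed.

End SheafSpectrum.

(** * Covered spaces as spectra *)

Section SpectrumFunctor.
Variables (R : realType) (N : nat).
Local Notation T := (projective_space N).
Implicit Types P Q S : flabby_sheaf R T.

Section Map.
Variables (P Q : flabby_sheaf R T) (h : sheaf_hom P Q).

Lemma factors_map (x : spectrum (Q (whole T))) (U : opens T) :
  factors x U -> @factors R N P (spec_map (h (whole T)) x) U.
Proof. by move=> xU s s0; apply: xU; rewrite -sheaf_fun_res s0 star_hom0. Qed.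

Lemma gspec_map_piece i :
  spec_map (h (whole T)) @` piece (gspec Q) i `<=` piece (gspec P) i.
Proof. by move=> _ [x xi <-]; exact: factors_map. Qed.

Definition gspec_map : covered_map (gspec Q) (gspec P) :=
  @CoveredMap N (gspec Q) (gspec P) (spec_map (h (whole T)))
    (@spec_map_continuous R _ _ (h (whole T))) gspec_map_piece.

End Map.

(** Closed transparently, since the components of the natural isomorphisms are typed by unfolding
    its action on objects. *)
Definition spectrum_functor :
    functor (flabby_sheaves R T) (opposite (covered_spaces N)).
refine (@Functor (flabby_sheaves R T) (opposite (covered_spaces N))
  (fun P : flabby_sheaf R T => gspec P) (fun P Q h => @gspec_map P Q h) _ _).
- by move=> P; apply: covered_map_eq => x; apply: spec_eq.
- by move=> P Q S f g; apply: covered_map_eq => x; apply: spec_eq.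
Defined.

End SpectrumFunctor.

(** Needed because [gelfand_map] goes from a sheaf to its function sheaf, against the direction
    required by [equivalent]. *)
Lemma naturally_isomorphic_sym (C D : category) (F G : functor C D) :
  naturally_isomorphic F G -> naturally_isomorphic G F.
Proof.
move=> [eta [nat_eta iso_eta]]; pose theta a := projT1 (cid (iso_eta a)).
have thP a : comp (theta a) (eta a) = idm _ /\ comp (eta a) (theta a) = idm _.
  exact: projT2 (cid (iso_eta a)).
exists theta; split => [a b f|a]; last by exists (eta a); case: (thP a).
have [_ e1] := thP a; have [e2 _] := thP b.
rewrite -[fmap G f in RHS]compm1 -e1 (compA (fmap G f)) nat_eta.
by rewrite !compA e2 comp1m.
Qed.

Section Evaluation.
Variables (R : realType) (N : nat) (X : covered_space N).
Local Notation T := (projective_space N).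
Local Notation C := (funsheaf R X (whole T)).

Lemma eval_character (x : X) : is_character (fun f : C => f x).
Proof. by split => //; exact: indic_funT. Qed.

Definition eval (x : X) : gspec (funsheaf_obj R X) := Spec (eval_character x).

Lemma eval_continuous : continuous eval.
Proof.
apply: (@continuous_spec R C X eval) => f.
by apply/continuous_subspace_setT; exact: (@bc_continuous _ _ _ f).
Qed.

Lemma function_of (f : X -> R[i]) : continuous f -> exists g : C, forall x, g x = f x.
Proof.
move=> cf; have [g hg] := @bcfun_of R N X (@region N X (whole T)) f
  (@closed_region N X _) (continuous_subspaceT cf).
by exists g => x; exact: hg.
Qed.

Lemma eval_inj : injective eval.
Proof.
move=> x y xy; apply: contrapT => nxy.
have [|f [cf f0 f1]] := @complex_urysohn R X (@cspace_compact _ X)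
  (@cspace_hausdorff _ X) [set y] x _ nxy.
  exact: (accessible_closed_set1 (hausdorff_accessible (@cspace_hausdorff _ X))).
have [g gf] := function_of cf.
have := congr1 (fun z : spectrum C => z g) xy; rewrite /= !gf f1 f0 // => /eqP.
by rewrite oner_eq0.
Qed.

(** If [z] is no evaluation, each [y] has an [f] with [z f] different from [f y]; the squared
    modulus of [f - z f] is killed by [z] and nonzero at [y]. Sums make the zero sets directed, so
    by compactness some function killed by [z] has no zero, hence is invertible. *)
Lemma eval_surj (z : gspec (funsheaf_obj R X)) : exists x, eval x = z.
Proof.
apply: contrapT => nz; pose zz := z : spectrum C.
have cz := char_ofP zz.
pose D := [set g : C | zz g = 0 /\ forall y, 0 <= g y].
pose B (g : C) := [set y | g y = 0].
have cont (g : C) : continuous g.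
  by apply/continuous_subspace_setT; exact: (@bc_continuous _ _ _ g).
have [||||g [g0 _] Bg0] := @compact_directed X C D B (@cspace_compact _ X).
- by exists 0; split; [exact: char0|move=> y /=].
- move=> g _; rewrite -[B g]/((g : X -> R[i]) @^-1` [set 0]).
  apply: preimage_closed; first by move=> y _; exact: cont.
  exact: (accessible_closed_set1 (hausdorff_accessible (@norm_hausdorff _ R[i]))).
- move=> g h [g0 gp] [h0 hp]; exists (g + h).
    split; first by rewrite (charD cz) g0 h0 addr0.
    by move=> y; exact: addr_ge0 (gp y) (hp y).
  by move=> y /= /eqP; rewrite paddr_eq0 // => /andP[/eqP ? /eqP ?].
- move=> y; have [f fy] : exists f : C, zz f != f y.
    apply: contrapT => h; apply: nz; exists y; apply: spec_eq => f /=.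
    by apply/eqP; rewrite eq_sym; apply: contrapT => /negP ne; apply: h; exists f.
  pose k : C := f - zz f *: cone.
  exists (cmul (star k) k).
    split; last first.
      by move=> w; rewrite -[leRHS]/((k w)^* * k w) mulrC; exact: mulcJ_ge0.
    by rewrite (charM cz) [zz k](charB cz) (charZ cz) (char1 cz) mulr1 subrr mulr0.
  move=> /= /eqP; rewrite mulf_eq0 conjc_eq0 orbb subr_eq0.
  have -> : (zz f *: cone : C) y = zz f * 1 by congr (_ * _); exact: indic_funT.
  by rewrite mulr1 eq_sym (negbTE fy).
have gn0 y : g y != 0.
  by apply/eqP => gy; have : B g y by []; rewrite Bg0.
have [|h hg] := @function_of (fun y => (g y)^-1).
  by move=> y; apply: cvgV => //; exact: cont.
have e : cmul g h = (cone : C).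
  apply: bcfun_eq => y; rewrite [RHS]indic_funT //=.
  by rewrite hg mulfV.
have := char1 cz; rewrite -e (charM cz) g0 mul0r => /eqP.
by rewrite eq_sym oner_eq0.
Qed.

(** Off the closed piece, Urysohn gives a function vanishing on the piece but not at [x]: a global
    section in the kernel of restriction to the chart that evaluation at [x] does not kill. *)
Lemma factors_eval x i : factors (eval x) (chart_opens i) <-> piece X i x.
Proof.
split=> [h|Xix].
  apply: contrapT => nx.
  have [f [cf f0 f1]] := @complex_urysohn R X (@cspace_compact _ X) (@cspace_hausdorff _ X)
    _ x (@piece_closed _ X i) nx.
  have [g gf] := function_of cf.
  have : g x = 0.
    apply: h; apply: bcfun_eq_on => y /(@coord_sigma N X) Xy.
    rewrite [LHS]funsheaf_resE; last exact/coord_sigma.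
    by rewrite gf f0.
  by rewrite gf f1 => /eqP; rewrite oner_eq0.
move=> s s0.
have Rx : @region N X (chart_opens i) x by exact/coord_sigma.
have := congr1 (fun u : bcfun R _ => u x) s0.
by rewrite [LHS]funsheaf_resE.
Qed.

Lemma eval_piece i : eval @` piece X i `<=` piece (gspec (funsheaf_obj R X)) i.
Proof. by move=> _ [x /factors_eval xi <-]. Qed.

Definition eval_map : covered_map X (gspec (funsheaf_obj R X)) :=
  CoveredMap eval_continuous eval_piece.

Lemma eval_inverse : exists g : covered_map (gspec (funsheaf_obj R X)) X,
  cancel eval_map g /\ cancel g eval_map.
Proof.
have /choice[u uK] := eval_surj.
have cu : continuous u.
  apply/continuous_closedP => F cF.
  (* A continuous bijection from a compact space to a Hausdorff one is closed. *)
  have -> : u @^-1` F = eval @` F.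
    apply/seteqP; split => [z Fz|_ [x Fx <-]]; first by exists (u z).
    by rewrite /preimage /= (eval_inj (uK (eval x))).
  apply: compact_closed; first exact: cspace_hausdorff.
  apply: continuous_compact; first exact/continuous_subspaceT/eval_continuous.
  exact: subclosed_compact cF (@cspace_compact _ X) _.
have pu i : u @` piece (gspec (funsheaf_obj R X)) i `<=` piece X i.
  by move=> _ [z zi <-]; apply/factors_eval; rewrite uK.
exists (CoveredMap cu pu); split => [x|z] /=; last exact: uK.
by apply: eval_inj; rewrite uK.
Qed.

End Evaluation.

(** * Flabby sheaves as function sheaves *)

Section GelfandSheaf.
Variables (R : realType) (N : nat) (P : flabby_sheaf R (projective_space N)).
Local Notation T := (projective_space N).
Local Notation X := (gspec P).
Local Notation A := (P (whole T)).
Local Notation rest U := (@res R T P (whole T) U (@subsetT T U)).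
Implicit Types (U V : opens T).

Definition lift U (s : P U) : A := projT1 (cid (rest_lift s)).

Lemma liftK U (s : P U) : rest U (lift s) = s.
Proof. exact: projT2 (cid (rest_lift s)). Qed.

Lemma factorsP (x : X) U : @region N X U x -> factors (x : spectrum A) U.
Proof. by rewrite region_gspec. Qed.

Lemma factors_eq (x : X) U (s t : A) : @region N X U x ->
  rest U s = rest U t -> (x : spectrum A) s = (x : spectrum A) t.
Proof.
move=> /factorsP xU st; apply/eqP; rewrite -subr_eq0 -(charB (char_ofP (x : spectrum A))).
by apply/eqP/xU; rewrite star_homB st subrr.
Qed.

(** The value does not depend on the lift, because [x] factors through [U]. Quantifying over all
    lifts [t] lets each algebraic law be checked with the most convenient one, although [lift]
    itself is an arbitrary choice. *)
Lemma gelfand_fun_exists U (s : P U) : exists g : bcfun R (@region N X U),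
  forall x t, @region N X U x -> rest U t = s -> g x = (x : spectrum A) t.
Proof.
have [g hg] := @bcfun_of R N X (@region N X U) (fun x : X => (x : spectrum A) (lift s))
  (@closed_region N X U) (continuous_subspaceT (@spec_eval_continuous R A (lift s))).
exists g => x t Ux ts; rewrite hg //; apply: factors_eq Ux _.
by rewrite liftK ts.
Qed.

Definition gelfand_fun U (s : P U) : funsheaf R X U := projT1 (cid (gelfand_fun_exists s)).

Lemma gelfand_funE U (s : P U) (x : X) t : @region N X U x -> rest U t = s ->
  gelfand_fun s x = (x : spectrum A) t.
Proof. exact: (projT2 (cid (gelfand_fun_exists s))). Qed.

Lemma gelfand_fun_linear U : linear (@gelfand_fun U).
Proof.
move=> c s t; apply: bcfun_eq_on => x Ux.
rewrite (@gelfand_funE _ _ x (c *: lift s + lift t)) //; last first.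
  by rewrite (star_fun_linear (rest U)) !liftK.
rewrite (charD (char_ofP (x : spectrum A))) (charZ (char_ofP (x : spectrum A))).
by rewrite -(gelfand_funE Ux (liftK s)) -(gelfand_funE Ux (liftK t)).
Qed.

Lemma gelfand_fun1 U : @gelfand_fun U cone = cone.
Proof.
apply: bcfun_eq_on => x Ux; rewrite (@gelfand_funE _ _ x cone) ?star_fun1 //.
by rewrite (char1 (char_ofP (x : spectrum A))) [RHS]indic_funT.
Qed.

Lemma gelfand_funM U : {morph @gelfand_fun U : s t / cmul s t}.
Proof.
move=> s t; apply: bcfun_eq_on => x Ux.
rewrite (@gelfand_funE _ _ x (cmul (lift s) (lift t))) ?star_funM ?liftK //.
rewrite (charM (char_ofP (x : spectrum A))).
by rewrite -(gelfand_funE Ux (liftK s)) -(gelfand_funE Ux (liftK t)).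
Qed.

Lemma gelfand_fun_star U : {morph @gelfand_fun U : s / star s}.
Proof.
move=> s; apply: bcfun_eq_on => x Ux.
rewrite (@gelfand_funE _ _ x (star (lift s))) ?star_fun_star ?liftK //.
rewrite (char_star (char_ofP (x : spectrum A))).
by rewrite -(gelfand_funE Ux (liftK s)).
Qed.

Definition gelfand_hom U : star_hom (P U) (funsheaf R X U) :=
  StarHom (@gelfand_fun_linear U) (@gelfand_fun1 U) (@gelfand_funM U) (@gelfand_fun_star U).

Lemma gelfand_hom_res U V (VU : V `<=` U) (s : P U) :
  gelfand_hom V (res P VU s) = res (funsheaf R X) VU (gelfand_hom U s).
Proof.
apply: bcfun_eq_on => x Vx; have Ux : @region N X U x by exact: (region_sub VU).
rewrite [RHS]funsheaf_resE // [RHS](gelfand_funE Ux (liftK s)).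
by apply: gelfand_funE => //; rewrite -{2}(liftK s) restK.
Qed.

Definition gelfand_map : sheaf_hom P (funsheaf R X) := SheafHom gelfand_hom_res.

(** Gelfand's theorem for [P U]: a character of [P U] pulled back along restriction is a point of
    the region, so equal functions have equal values at all characters of [P U]. *)
Lemma gelfand_hom_inj U : injective (gelfand_hom U).
Proof.
move=> s t st; apply: gelfand_inj => y.
pose x : X := spec_map (rest U) y.
have Ux : @region N X U x.
  by rewrite region_gspec => u u0; rewrite /= u0 (char0 (char_ofP y)).
have e (u : P U) : gelfand_hom U u x = y u.
  by rewrite [LHS](gelfand_funE Ux (liftK u)) /= liftK.
by rewrite -!e st.
Qed.

(** Tietze extends [g] to the whole spectrum; the extension is the transform of a global section,
    which is then restricted to [U]. *)
Lemma gelfand_hom_surj U (g : funsheaf R X U) : exists s, gelfand_hom U s = g.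
Proof.
have [f cf fg] := funsheaf_extension g.
have [a ha] := @gelfand_surj R A f cf.
exists (rest U a); apply: bcfun_eq_on => x Ux.
by rewrite [LHS](gelfand_funE Ux erefl) ha fg.
Qed.

End GelfandSheaf.

Section SheafIso.
Variables (R : realType) (T : topologicalType) (P Q : sheaf R T) (h : sheaf_hom P Q).

Lemma sheaf_hom_inverse :
  (forall U, injective (h U)) -> (forall U t, exists s, h U s = t) ->
  exists g : sheaf_hom Q P, sheaf_comp g h = sheaf_id P /\ sheaf_comp h g = sheaf_id Q.
Proof.
move=> inj surj; pose g U t := projT1 (cid (surj U t)).
have gK U t : h U (g U t) = t by exact: projT2 (cid (surj U t)).
have glin U : linear (g U) by move=> c s t; apply: inj; rewrite star_fun_linear !gK.
have g1 U : g U cone = cone by apply: inj; rewrite star_fun1 gK.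
have gM U : {morph g U : s t / cmul s t} by move=> s t; apply: inj; rewrite star_funM !gK.
have gS U : {morph g U : s / star s} by move=> s; apply: inj; rewrite star_fun_star !gK.
have gres (U V : opens T) (VU : V `<=` U) t : g V (res Q VU t) = res P VU (g U t).
  by apply: inj; rewrite sheaf_fun_res !gK.
exists (@SheafHom R T Q P (fun U => StarHom (glin U) (g1 U) (gM U) (gS U)) gres).
split; apply: sheaf_hom_eq => U s; last exact: gK.
by apply: inj; exact: gK.
Qed.

End SheafIso.

Theorem corollary4p6 (R : realType) (N : nat) (hN : (1 <= N)%N) :
  contravariantly_equivalent
    (covered_spaces N) (flabby_sheaves R (projective_space N)).
Proof.
exists (functions_functor R N), (spectrum_functor R N); split.
(* In the opposite category, the map from [X] to the spectrum is a morphism towards [X], as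
   required. *)
- exists (fun X => eval_map R X); split.
    move=> X Y f; apply: covered_map_eq => x; apply: spec_eq => g /=.
    by rewrite indic_funT.
  move=> X; have [g [gK Kg]] := eval_inverse R X.
  by exists g; split; apply: covered_map_eq.
apply: naturally_isomorphic_sym; exists (fun P => gelfand_map P); split.
  move=> P Q h; apply: sheaf_hom_eq => U s; apply: bcfun_eq_on => x Ux.
  have fx : @region N (gspec P) U (gspec_map h x) by exact: region_map Ux.
  rewrite [LHS]indic_funT // [LHS](gelfand_funE fx (liftK s)).
  (* The lift of [h U s] is taken to be the image under [h] of the lift of [s]. *)
  rewrite [RHS](@gelfand_funE R N Q U (h U s) x (h (whole _) (lift s))) //.
  by rewrite -sheaf_fun_res liftK.
move=> P; apply: sheaf_hom_inverse.
  exact: gelfand_hom_inj.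
exact: gelfand_hom_surj.
Qed.
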